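(* Let $\mathcal{C}$ be a triangulated category endowed with a weight structure $w$, and let $\mathcal{A}:\underline{Hw}\to A$ be an additive functor, where $A$ is any abelian category. Choose a weight complex $t(M)=(M^j)$ for each $M\in\mathrm{Obj}\,\mathcal{C}$, and denote by $H(M)=H^{\mathcal{A}}(M)$ the zeroth homology of the complex $(\mathcal{A}(M^j))_j$ (i.e., its homology at $\mathcal{A}(M^0)$). Then $H(-)$ yields a homological functor $\mathcal{C}\to A$ that does not depend on the choices of weight complexes. Moreover, the assignment $\mathcal{A}\mapsto H^{\mathcal{A}}$ is natural in $\mathcal{A}$.
   Context: Weight structures: a pair $(\mathcal{C}_{w\le 0},\mathcal{C}_{w\ge 0})$ of classes of objects such that: (i) both are closed under retracts in $\mathcal{C}$; (ii) $\mathcal{C}_{w\le 0}\subset \mathcal{C}_{w\le 0}[1]$ and $\mathcal{C}_{w\ge 0}[1]\subset \mathcal{C}_{w\ge 0}$; (iii) $\mathcal{C}(X,Y)=0$ for $X\in\mathcal{C}_{w\le 0}$, $Y\in \mathcal{C}_{w\ge 0}[1]$; (iv) every object $M$ fits in a distinguished triangle $LM\to M\to RM\to LM[1]$ with $LM\in\mathcal{C}_{w\le 0}$, $RM\in \mathcal{C}_{w\ge 0}[1]$. Put $\mathcal{C}_{w\le i}=\mathcal{C}_{w\le 0}[i]$, $\mathcal{C}_{w\ge i}=\mathcal{C}_{w\ge 0}[i]$. The heart $\underline{Hw}$ is the full subcategory on $\mathcal{C}_{w\le 0}\cap\mathcal{C}_{w\ge 0}$. Weight complexes: for $M\in\mathrm{Obj}\,\mathcal{C}$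 choose for all $i\in\mathbb{Z}$ distinguished triangles $w_{\le i}M\xrightarrow{h_i}M\to w_{\ge i+1}M\to$ with $w_{\le i}M\in\mathcal{C}_{w\le i}$, $w_{\ge i+1}M\in\mathcal{C}_{w\ge i+1}$. There are unique $j_i:w_{\le i}M\to w_{\le i+1}M$ with $h_{i+1}\circ j_i=h_i$; choose distinguished triangles $w_{\le i-1}M\xrightarrow{j_{i-1}}w_{\le i}M\to M_i\to w_{\le i-1}M[1]$. Put $M^p=M_{-p}[p]$; these objects belong to $\underline{Hw}$. The differential $M^p\to M^{p+1}$ is the shift by $[p]$ of the composition $M_{-p}\to w_{\le -p-1}M[1]\to M_{-p-1}[1]$. Any complex $(M^p)$ obtained this way is called (a choice of) a weight complex of $M$ (complexes are cohomological). Any morphism $g:M\to M'$ in $\mathcal{C}$ extends to a morphism of these data, hence to a morphism of the chosen weight complexes; this is how $H$ is defined on morphisms. *)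

(* Defs.v *)
From mathcomp Require Import all_boot all_order all_algebra.
From mathcomp Require Import boolp.

Set Implicit Arguments.
Unset Strict Implicit.
Unset Printing Implicit Defensive.

Import GRing.Theory.
Local Open Scope ring_scope.

Declare Scope cat_scope.
Delimit Scope cat_scope with cat.
Local Open Scope cat_scope.
Reserved Notation "g \co f" (at level 41, right associativity).

(* A preadditive category; [cmp g f], written [g \co f], is [g] after [f]. *)
Record precat := Precat {
  obj :> Type;
  Hom : obj -> obj -> zmodType;
  idm : forall X, Hom X X;
  cmp : forall X Y Z, Hom Y Z -> Hom X Y -> Hom X Z;
  cmpA : forall X Y Z T (h : Hom Z T) (g : Hom Y Z) (f : Hom X Y),
    cmp h (cmp g f) = cmp (cmp h g) f;
  cmp1m : forall X Y (f : Hom X Y), cmp (idm Y) f = f;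
  cmpm1 : forall X Y (f : Hom X Y), cmp f (idm X) = f;
  cmpDl : forall X Y Z (g g' : Hom Y Z) (f : Hom X Y),
    cmp (g + g') f = cmp g f + cmp g' f;
  cmpDr : forall X Y Z (g : Hom Y Z) (f f' : Hom X Y),
    cmp g (f + f') = cmp g f + cmp g f' }.

Arguments Hom {p} X Y.
Arguments idm {p} X.
Notation "g \co f" := (cmp g f) : cat_scope.

Section PrecatTheory.
Variable C : precat.
Implicit Types X Y Z : C.

Definition is_iso X Y (f : Hom X Y) : Prop :=
  exists2 g : Hom Y X, g \co f = idm X & f \co g = idm Y.

Definition isomorphic X Y : Prop := exists f : Hom X Y, is_iso f.

Definition retract_of X Y : Prop :=
  exists (i : Hom X Y) (p : Hom Y X), p \co i = idm X.

Definition retract_closed (P : C -> Prop) : Prop :=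
  forall X Y, P Y -> retract_of X Y -> P X.

Definition is_zero X : Prop := idm X = 0.

Definition is_biproduct X Y P (i : Hom X P) (j : Hom Y P)
    (p : Hom P X) (q : Hom P Y) : Prop :=
  [/\ p \co i = idm X, q \co j = idm Y, q \co i = 0, p \co j = 0
    & i \co p + j \co q = idm P].

Definition mono X Y (f : Hom X Y) : Prop :=
  forall W (g h : Hom W X), f \co g = f \co h -> g = h.

Definition epi X Y (f : Hom X Y) : Prop :=
  forall W (g h : Hom Y W), g \co f = h \co f -> g = h.

Definition is_kernel X Y (f : Hom X Y) K (k : Hom K X) : Prop :=
  f \co k = 0 /\
  forall W (g : Hom W X), f \co g = 0 -> exists! l : Hom W K, k \co l = g.

Definition is_cokernel X Y (f : Hom X Y) Q (q : Hom Y Q) : Prop :=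
  q \co f = 0 /\
  forall W (g : Hom Y W), g \co f = 0 -> exists! l : Hom Q W, l \co q = g.

Lemma cmp0m X Y Z (f : Hom X Y) : (0 : Hom Y Z) \co f = 0.
Proof. by apply: (addrI (0 \co f)); rewrite -cmpDl !addr0. Qed.

Lemma cmpm0 X Y Z (g : Hom Y Z) : g \co (0 : Hom X Y) = 0.
Proof. by apply: (addrI (g \co 0)); rewrite -cmpDr !addr0. Qed.

Lemma cmpNl X Y Z (g : Hom Y Z) (f : Hom X Y) : (- g) \co f = - (g \co f).
Proof. by apply/eqP; rewrite -subr_eq0 opprK -cmpDl addNr cmp0m. Qed.

Lemma cmpNr X Y Z (g : Hom Y Z) (f : Hom X Y) : g \co (- f) = - (g \co f).
Proof. by apply/eqP; rewrite -subr_eq0 opprK -cmpDr addNr cmpm0. Qed.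

Lemma cmpBr X Y Z (g : Hom Y Z) (f f' : Hom X Y) :
  g \co (f - f') = g \co f - g \co f'.
Proof. by rewrite cmpDr cmpNr. Qed.

End PrecatTheory.

Definition is_additive_functor (C D : precat) (F0 : C -> D)
    (F1 : forall X Y : C, Hom X Y -> Hom (F0 X) (F0 Y)) : Prop :=
  [/\ forall X, F1 X X (idm X) = idm (F0 X),
      forall X Y Z (g : Hom Y Z) (f : Hom X Y),
        F1 X Z (g \co f) = F1 Y Z g \co F1 X Y f
    & forall X Y (f g : Hom X Y), F1 X Y (f + g) = F1 X Y f + F1 X Y g].

(* Functors between preadditive categories are additive by definition. *)
Record functor (C D : precat) := Functor {
  fobj :> C -> D;
  fmap : forall X Y : C, Hom X Y -> Hom (fobj X) (fobj Y);
  fmapP : is_additive_functor fmap }.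

Arguments fmap {C D} F {X Y} f : rename.

Definition is_natural (C D : precat) (F0 G0 : C -> D)
    (F1 : forall X Y : C, Hom X Y -> Hom (F0 X) (F0 Y))
    (G1 : forall X Y : C, Hom X Y -> Hom (G0 X) (G0 Y))
    (phi : forall X, Hom (F0 X) (G0 X)) : Prop :=
  forall X Y (f : Hom X Y), phi Y \co F1 X Y f = G1 X Y f \co phi X.

Record ntrans (C D : precat) (F G : functor C D) := NTrans {
  nt_at :> forall X : C, Hom (F X) (G X);
  nt_natural : is_natural (@fmap _ _ F) (@fmap _ _ G) nt_at }.

Section FunctorTheory.
Variables (C D : precat) (F : functor C D).

Lemma fmap1 (X : C) : fmap F (idm X) = idm (F X).
Proof. by case: (fmapP F). Qed.

Lemma fmapM (X Y Z : C) (g : Hom Y Z) (f : Hom X Y) :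
  fmap F (g \co f) = fmap F g \co fmap F f.
Proof. by case: (fmapP F). Qed.

Lemma fmapD (X Y : C) (f g : Hom X Y) : fmap F (f + g) = fmap F f + fmap F g.
Proof. by case: (fmapP F). Qed.

Lemma fmap0 (X Y : C) : fmap F (0 : Hom X Y) = 0.
Proof. by apply: (addrI (fmap F 0)); rewrite -fmapD !addr0. Qed.

Lemma fmapB (X Y : C) (f g : Hom X Y) : fmap F (f - g) = fmap F f - fmap F g.
Proof. by apply/eqP; rewrite eq_sym subr_eq -fmapD addrNK. Qed.

End FunctorTheory.

Lemma idF_subproof (C : precat) :
  @is_additive_functor C C id (fun X Y f => f).
Proof. by []. Qed.
Definition idF (C : precat) : functor C C := Functor (idF_subproof C).

Lemma compF_subproof (C D E : precat) (G : functor D E) (F : functor C D) :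
  @is_additive_functor C E (fun X => G (F X)) (fun X Y f => fmap G (fmap F f)).
Proof. by split=> *; rewrite ?(fmap1, fmapM, fmapD). Qed.
Definition compF (C D E : precat) (G : functor D E) (F : functor C D) :
  functor C E := Functor (compF_subproof G F).

(* [iterF n.+1 F X] unfolds to [iterF n F (F X)]. *)
Fixpoint iterF (C : precat) (n : nat) (F : functor C C) : functor C C :=
  if n is n'.+1 then compF (iterF n' F) F else idF C.

Lemma idN_subproof (C D : precat) (F : functor C D) :
  is_natural (@fmap _ _ F) (@fmap _ _ F) (fun X => idm (F X)).
Proof. by move=> X Y f; rewrite cmp1m cmpm1. Qed.
Definition idN (C D : precat) (F : functor C D) : ntrans F F :=
  NTrans (idN_subproof F).

Lemma compN_subproof (C D : precat) (F G H : functor C D)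
    (psi : ntrans G H) (phi : ntrans F G) :
  is_natural (@fmap _ _ F) (@fmap _ _ H) (fun X => psi X \co phi X).
Proof.
move=> X Y f; rewrite -cmpA (nt_natural phi) cmpA.
by have -> := nt_natural psi f; rewrite cmpA.
Qed.
Definition compN (C D : precat) (F G H : functor C D)
    (psi : ntrans G H) (phi : ntrans F G) : ntrans F H :=
  NTrans (compN_subproof psi phi).

Record additive_cat := AdditiveCat {
  add_cat :> precat;
  has_zero : exists Z : add_cat, is_zero Z;
  has_biproducts : forall X Y : add_cat,
    exists P (i : Hom X P) (j : Hom Y P) (p : Hom P X) (q : Hom P Y),
      is_biproduct i j p q }.

Record abelian_cat := AbelianCat {
  ab_cat :> additive_cat;
  has_kernels : forall (X Y : ab_cat) (f : Hom X Y),
    exists K (k : Hom K X), is_kernel f k;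
  has_cokernels : forall (X Y : ab_cat) (f : Hom X Y),
    exists Q (q : Hom Y Q), is_cokernel f q;
  mono_normal : forall (X Y : ab_cat) (f : Hom X Y), mono f ->
    exists Z (g : Hom Y Z), is_kernel g f;
  epi_normal : forall (X Y : ab_cat) (f : Hom X Y), epi f ->
    exists W (g : Hom W X), is_cokernel g f }.

Section Homology.
Variable A : abelian_cat.
Implicit Types X Y Z : A.

Definition ker X Y (f : Hom X Y) : A := projT1 (cid (has_kernels f)).
Definition kerm X Y (f : Hom X Y) : Hom (ker f) X :=
  projT1 (cid (projT2 (cid (has_kernels f)))).
Lemma kermP X Y (f : Hom X Y) : is_kernel f (kerm f).
Proof. exact: projT2 (cid (projT2 (cid (has_kernels f)))). Qed.

Definition coker X Y (f : Hom X Y) : A := projT1 (cid (has_cokernels f)).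
Definition cokerm X Y (f : Hom X Y) : Hom Y (coker f) :=
  projT1 (cid (projT2 (cid (has_cokernels f)))).
Lemma cokermP X Y (f : Hom X Y) : is_cokernel f (cokerm f).
Proof. exact: projT2 (cid (projT2 (cid (has_cokernels f)))). Qed.

Definition ker_lift X Y (f : Hom X Y) W (g : Hom W X) (fg0 : f \co g = 0) :
  Hom W (ker f) := projT1 (cid ((kermP f).2 W g fg0)).
Lemma ker_liftK X Y (f : Hom X Y) W (g : Hom W X) (fg0 : f \co g = 0) :
  kerm f \co ker_lift fg0 = g.
Proof. by have [] := projT2 (cid ((kermP f).2 W g fg0)). Qed.

Definition coker_desc X Y (f : Hom X Y) W (g : Hom Y W) (gf0 : g \co f = 0) :
  Hom (coker f) W := projT1 (cid ((cokermP f).2 W g gf0)).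
Lemma coker_descK X Y (f : Hom X Y) W (g : Hom Y W) (gf0 : g \co f = 0) :
  coker_desc gf0 \co cokerm f = g.
Proof. by have [] := projT2 (cid ((cokermP f).2 W g gf0)). Qed.

Lemma kerm_mono X Y (f : Hom X Y) : mono (kerm f).
Proof.
move=> W g h e; have [k0 U] := kermP f.
have [|l [_ Ul]] := U W (kerm f \co h); first by rewrite cmpA k0 cmp0m.
by rewrite -(Ul g e) -(Ul h erefl).
Qed.

(* For [X --f--> Y --g--> Z]: the cokernel of the lift of [f] to [ker g]. *)
Definition homology X Y Z (f : Hom X Y) (g : Hom Y Z) (gf0 : g \co f = 0) : A :=
  coker (ker_lift gf0).

Section HomologyMap.
Variables (X Y Z X' Y' Z' : A) (f : Hom X Y) (g : Hom Y Z).
Variables (f' : Hom X' Y') (g' : Hom Y' Z').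
Hypotheses (gf0 : g \co f = 0) (gf0' : g' \co f' = 0).
Variables (a : Hom X X') (b : Hom Y Y') (c : Hom Z Z').
Hypotheses (abE : b \co f = f' \co a) (bcE : c \co g = g' \co b).

Lemma homology_map_subproof1 : g' \co (b \co kerm g) = 0.
Proof. by rewrite cmpA -bcE -cmpA (kermP g).1 cmpm0. Qed.

Lemma homology_map_subproof2 :
  (cokerm (ker_lift gf0') \co ker_lift homology_map_subproof1)
    \co ker_lift gf0 = 0.
Proof.
have e : ker_lift homology_map_subproof1 \co ker_lift gf0
         = ker_lift gf0' \co a.
  by apply: kerm_mono; rewrite !cmpA !ker_liftK -cmpA ker_liftK.
by rewrite -cmpA e cmpA (cokermP (ker_lift gf0')).1 cmp0m.
Qed.

Definition homology_map : Hom (homology gf0) (homology gf0') :=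
  coker_desc homology_map_subproof2.

End HomologyMap.

Definition exact_at X Y Z (f : Hom X Y) (g : Hom Y Z) : Prop :=
  exists gf0 : g \co f = 0, is_zero (homology gf0).

End Homology.

Record complex (C : precat) := Complex {
  term :> int -> C;
  diff : forall p : int, Hom (term p) (term (p + 1));
  diffK : forall p : int, diff (p + 1) \co diff p = 0 }.

Record chain_map (C : precat) (K L : complex C) := ChainMap {
  cm_at :> forall p : int, Hom (K p) (L p);
  cm_diff : forall p : int, cm_at (p + 1) \co diff K p = diff L p \co cm_at p }.

Section FunctorOnComplexes.
Variables (C D : precat) (F : functor C D).

Lemma mapK_subproof (K : complex C) p :
  fmap F (diff K (p + 1)) \co fmap F (diff K p) = 0.
Proof. by rewrite -fmapM diffK fmap0. Qed.
Definition mapK (K : complex C) : complex D :=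
  @Complex D (fun p => F (K p)) (fun p => fmap F (diff K p)) (mapK_subproof K).

Lemma mapC_subproof (K L : complex C) (f : chain_map K L) p :
  fmap F (f (p + 1)) \co diff (mapK K) p
  = diff (mapK L) p \co fmap F (f p).
Proof. by rewrite /= -!fmapM cm_diff. Qed.
Definition mapC (K L : complex C) (f : chain_map K L) :
  chain_map (mapK K) (mapK L) := @ChainMap D (mapK K) (mapK L) (fun p => fmap F (f p)) (mapC_subproof f).

End FunctorOnComplexes.

Lemma mapN_subproof (C D : precat) (F G : functor C D) (phi : ntrans F G)
    (K : complex C) p :
  phi (K (p + 1)) \co diff (mapK F K) p = diff (mapK G K) p \co phi (K p).
Proof. exact: nt_natural. Qed.
Definition mapN (C D : precat) (F G : functor C D) (phi : ntrans F G)
  (K : complex C) : chain_map (mapK F K) (mapK G K) :=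
  @ChainMap D (mapK F K) (mapK G K) (fun p => phi (K p)) (mapN_subproof phi K).

(* [-1 + 1] and [0] are convertible in [int], so that [diff K (-1)] is a
   morphism from [K (-1)] to [K 0]. *)
Definition H0 (A : abelian_cat) (K : complex A) : A :=
  @homology A (K (-1)) (K 0) (K 1) (diff K (-1)) (diff K 0) (diffK K (-1)).

Definition H0map (A : abelian_cat) (K L : complex A) (f : chain_map K L) :
  Hom (H0 K) (H0 L) :=
  @homology_map A (K (-1)) (K 0) (K 1) (L (-1)) (L 0) (L 1)
    (diff K (-1)) (diff K 0) (diff L (-1)) (diff L 0)
    (diffK K (-1)) (diffK L (-1)) (f (-1)) (f 0) (f 1)
    (cm_diff f (-1)) (cm_diff f 0).

(* The shift [1] is an additive autoequivalence [sh] with a chosen quasi-inverse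
   [unsh]; it need not be a strict automorphism. [dist_id] and [dist_ex] are TR1
   with [dist_iso], [dist_rot] is TR2, [dist_mor] TR3 and [dist_oct] the
   octahedral axiom. *)
Record triangulated_cat := TriangulatedCat {
  tri_cat :> additive_cat;
  sh : functor tri_cat tri_cat;
  unsh : functor tri_cat tri_cat;
  unsh_sh : ntrans (compF unsh sh) (idF tri_cat);
  unsh_sh_iso : forall X, is_iso (unsh_sh X);
  sh_unsh : ntrans (compF sh unsh) (idF tri_cat);
  sh_unsh_iso : forall X, is_iso (sh_unsh X);
  dist : forall X Y Z : tri_cat, Hom X Y -> Hom Y Z -> Hom Z (sh X) -> Prop;
  dist_iso : forall (X Y Z X' Y' Z' : tri_cat)
      (f : Hom X Y) (g : Hom Y Z) (h : Hom Z (sh X))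
      (f' : Hom X' Y') (g' : Hom Y' Z') (h' : Hom Z' (sh X'))
      (a : Hom X X') (b : Hom Y Y') (c : Hom Z Z'),
    is_iso a -> is_iso b -> is_iso c ->
    b \co f = f' \co a -> c \co g = g' \co b -> fmap sh a \co h = h' \co c ->
    dist f g h -> dist f' g' h';
  dist_id : forall X Z : tri_cat, is_zero Z ->
    dist (idm X) (0 : Hom X Z) (0 : Hom Z (sh X));
  dist_ex : forall (X Y : tri_cat) (f : Hom X Y),
    exists Z (g : Hom Y Z) (h : Hom Z (sh X)), dist f g h;
  dist_rot : forall (X Y Z : tri_cat)
      (f : Hom X Y) (g : Hom Y Z) (h : Hom Z (sh X)),
    dist f g h <-> dist g h (- fmap sh f);
  dist_mor : forall (X Y Z X' Y' Z' : tri_cat)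
      (f : Hom X Y) (g : Hom Y Z) (h : Hom Z (sh X))
      (f' : Hom X' Y') (g' : Hom Y' Z') (h' : Hom Z' (sh X'))
      (a : Hom X X') (b : Hom Y Y'),
    dist f g h -> dist f' g' h' -> b \co f = f' \co a ->
    exists2 c : Hom Z Z', c \co g = g' \co b & fmap sh a \co h = h' \co c;
  dist_oct : forall (X Y Z U V W : tri_cat) (f : Hom X Y) (g : Hom Y Z)
      (a : Hom Y U) (a' : Hom U (sh X)) (b : Hom Z V) (b' : Hom V (sh Y))
      (c : Hom Z W) (c' : Hom W (sh X)),
    dist f a a' -> dist g b b' -> dist (g \co f) c c' ->
    exists (s : Hom U W) (t : Hom W V),
      [/\ dist s t (fmap sh a \co b'), s \co a = c \co g, t \co c = b,
          c' \co s = a' & b' \co t = fmap sh f \co c'] }.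

Arguments sh {t}.
Arguments unsh {t}.
Arguments unsh_sh {t}.
Arguments sh_unsh {t}.

Definition homological (C : triangulated_cat) (A : abelian_cat) (F0 : C -> A)
    (F1 : forall X Y : C, Hom X Y -> Hom (F0 X) (F0 Y)) : Prop :=
  is_additive_functor F1 /\
  forall (X Y Z : C) (f : Hom X Y) (g : Hom Y Z) (h : Hom Z (sh X)),
    dist f g h -> exact_at (F1 X Y f) (F1 Y Z g).

Definition shift (C : triangulated_cat) (n : int) : functor C C :=
  match n with Posz m => iterF m sh | Negz m => iterF m.+1 unsh end.

Definition succz (n : int) : int :=
  match n with Posz m => Posz m.+1 | Negz 0 => 0 | Negz m.+1 => Negz m end.

Lemma succzE (n : int) : succz n = n + 1.
Proof.
case: n => [n|[|n]] //=; first by rewrite addrC -intS.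
by rewrite !NegzE (intS n.+1) opprD addrC addrA subrr add0r.
Qed.

(* The canonical isomorphism [X[1][n] -> X[n + 1]]. *)
Definition shift_succ (C : triangulated_cat) (n : int) (X : C) :
    Hom (shift C n (sh X)) (shift C (succz n) X) :=
  match n with
  | Posz m => idm (iterF m sh (sh X))
  | Negz 0 => unsh_sh X
  | Negz m.+1 => fmap (iterF m.+1 unsh) (unsh_sh X)
  end.

(* The class [P[n]], i.e. the essential image of [P] under the shift by [n]. *)
Definition shifted (C : triangulated_cat) (P : C -> Prop) (n : int) (X : C) :
  Prop := exists2 Y, P Y & isomorphic X (shift C n Y).

Record weight_structure (C : triangulated_cat) := WeightStructure {
  wle : C -> Prop;
  wge : C -> Prop;
  wle_retract : retract_closed wle;
  wge_retract : retract_closed wge;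
  wle_shift : forall X, wle X -> shifted wle 1 X;
  wge_shift : forall X, shifted wge 1 X -> wge X;
  w_orth : forall X Y, wle X -> shifted wge 1 Y -> forall f : Hom X Y, f = 0;
  w_decomp : forall M : C,
    exists L R (f : Hom L M) (g : Hom M R) (h : Hom R (sh L)),
      [/\ wle L, shifted wge 1 R & dist f g h] }.

Section Heart.
Variables (C : triangulated_cat) (w : weight_structure C).

Definition wleq (i : int) (X : C) : Prop := shifted (wle w) i X.
Definition wgeq (i : int) (X : C) : Prop := shifted (wge w) i X.

Definition in_heart (X : C) : Prop := wle w X /\ wge w X.

Let heart_obj := {X : C | in_heart X}.
Definition heart : precat :=
  @Precat heart_obj (fun X Y => Hom (sval X) (sval Y)) (fun X => idm (sval X))
    (fun X Y Z g f => g \co f)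
    (fun X Y Z T h g f => cmpA h g f) (fun X Y f => cmp1m f)
    (fun X Y f => cmpm1 f)
    (fun X Y Z g g' f => cmpDl g g' f) (fun X Y Z g f f' => cmpDr g f f').

End Heart.

(* The triangles [wt_le i -> M -> wt_ge (i + 1)] are those of the weight
   decompositions [w_{<= i} M -> M -> w_{>= i+1} M]; [wt_gr i] is the cone of the
   transition morphism [wt_j i : w_{<= i-1} M -> w_{<= i} M]. *)
Record wdata (C : triangulated_cat) (w : weight_structure C) (M : C) := WData {
  wt_le : int -> C;
  wt_ge : int -> C;
  wt_leP : forall i, wleq w i (wt_le i);
  wt_geP : forall i, wgeq w i (wt_ge i);
  wt_h : forall i, Hom (wt_le i) M;
  wt_r : forall i, Hom M (wt_ge (i + 1));
  wt_b : forall i, Hom (wt_ge (i + 1)) (sh (wt_le i));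
  wt_dist : forall i, dist (wt_h i) (wt_r i) (wt_b i);
  wt_j : forall i, Hom (wt_le (i - 1)) (wt_le i);
  wt_jE : forall i, wt_h i \co wt_j i = wt_h (i - 1);
  wt_gr : int -> C;
  wt_u : forall i, Hom (wt_le i) (wt_gr i);
  wt_v : forall i, Hom (wt_gr i) (sh (wt_le (i - 1)));
  wt_gr_dist : forall i, dist (wt_j i) (wt_u i) (wt_v i) }.

(* Morphisms of the data above lying over [g]. *)
Record wmor (C : triangulated_cat) (w : weight_structure C) (M N : C)
    (g : Hom M N) (D : wdata w M) (E : wdata w N) := WMor {
  wm_le : forall i, Hom (wt_le D i) (wt_le E i);
  wm_ge : forall i, Hom (wt_ge D i) (wt_ge E i);
  wm_gr : forall i, Hom (wt_gr D i) (wt_gr E i);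
  wm_h : forall i, g \co wt_h D i = wt_h E i \co wm_le i;
  wm_r : forall i, wm_ge (i + 1) \co wt_r D i = wt_r E i \co g;
  wm_b : forall i,
    fmap sh (wm_le i) \co wt_b D i = wt_b E i \co wm_ge (i + 1);
  wm_j : forall i, wm_le i \co wt_j D i = wt_j E i \co wm_le (i - 1);
  wm_u : forall i, wm_gr i \co wt_u D i = wt_u E i \co wm_le i;
  wm_v : forall i,
    fmap sh (wm_le (i - 1)) \co wt_v D i = wt_v E i \co wm_gr i }.

Section IsoTheory.
Variable C : precat.
Implicit Types X Y Z : C.

Lemma isomorphic_refl X : isomorphic X X.
Proof. by exists (idm X), (idm X); rewrite cmp1m. Qed.

Lemma isomorphic_sym X Y : isomorphic X Y -> isomorphic Y X.
Proof. by case=> f [g gf fg]; exists g, f. Qed.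

Lemma isomorphic_trans Y X Z :
  isomorphic X Y -> isomorphic Y Z -> isomorphic X Z.
Proof.
case=> f [f' e1 e2] [g [g' e3 e4]]; exists (g \co f), (f' \co g').
  by rewrite -cmpA (cmpA g') e3 cmp1m.
by rewrite -cmpA (cmpA f) e2 cmp1m.
Qed.

Lemma isomorphic_fmap (D : precat) (F : functor C D) X Y :
  isomorphic X Y -> isomorphic (F X) (F Y).
Proof.
by case=> f [g e1 e2]; exists (fmap F f), (fmap F g); rewrite -fmapM ?e1 ?e2 fmap1.
Qed.

Definition homz X Y : Prop := forall f : Hom X Y, f = 0.

Lemma homz_iso X Y X' Y' :
  isomorphic X X' -> isomorphic Y Y' -> homz X Y -> homz X' Y'.
Proof.
case=> a [a' e1 e2] [b [b' e3 e4]] z f.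
have := z (b' \co f \co a) => e.
have -> : f = b \co (b' \co f \co a) \co a'.
  by rewrite -!cmpA e2 cmpm1 cmpA e4 cmp1m.
by rewrite e cmp0m cmpm0.
Qed.

Lemma retract_closed_iso (P : C -> Prop) X Y :
  retract_closed P -> isomorphic X Y -> P Y -> P X.
Proof. by move=> rP [f [g gf fg]] PY; apply: rP PY _; exists f, g. Qed.

Lemma iterF_swap (F : functor C C) n X : iterF n F (F X) = F (iterF n F X).
Proof. by elim: n X => //= n IH X; rewrite IH. Qed.

Lemma iterF_cancel (F G : functor C C) n X :
  (forall Y, isomorphic (G (F Y)) Y) ->
  isomorphic (iterF n G (iterF n F X)) X.
Proof.
move=> GF; elim: n X => [|n IH] X /=; first exact: isomorphic_refl.
rewrite (iterF_swap F); apply: isomorphic_trans (IH X).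
exact: (@isomorphic_fmap _ (iterF n G)) (GF _).
Qed.

Lemma iterF_faithful (F : functor C C) n :
  (forall X Y (f : Hom X Y), fmap F f = 0 -> f = 0) ->
  forall X Y (f : Hom X Y), fmap (iterF n F) f = 0 -> f = 0.
Proof. by move=> fF; elim: n => //= n IH X Y f /IH/fF. Qed.

End IsoTheory.

Section TriangleTheory.
Variable C : triangulated_cat.
Implicit Types X Y Z T : C.

Lemma unsh_sh_isom X : isomorphic (unsh (sh X)) X.
Proof. by exists (unsh_sh X); apply: unsh_sh_iso. Qed.

Lemma sh_unsh_isom X : isomorphic (sh (unsh X)) X.
Proof. by exists (sh_unsh X); apply: sh_unsh_iso. Qed.

Lemma sh_faithful X Y (f : Hom X Y) : fmap sh f = 0 -> f = 0.
Proof.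
move=> f0; have [g e1 e2] := unsh_sh_iso X.
have := nt_natural unsh_sh f; rewrite /= f0 fmap0 cmpm0 => e.
by rewrite -(cmpm1 f) -e2 cmpA -e cmp0m.
Qed.

Lemma unsh_faithful X Y (f : Hom X Y) : fmap unsh f = 0 -> f = 0.
Proof.
move=> f0; have [g e1 e2] := sh_unsh_iso X.
have := nt_natural sh_unsh f; rewrite /= f0 fmap0 cmpm0 => e.
by rewrite -(cmpm1 f) -e2 cmpA -e cmp0m.
Qed.

Lemma sh_full X Y (c : Hom (sh X) (sh Y)) : exists f, c = fmap sh f.
Proof.
have [a a1 a2] := unsh_sh_iso X; have [b b1 b2] := unsh_sh_iso Y.
exists (unsh_sh Y \co fmap unsh c \co a); apply/eqP; rewrite -subr_eq0; apply/eqP.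
set l := (_ \co _ \co a).
apply: unsh_faithful.
have := nt_natural unsh_sh l; rewrite /= /l -!cmpA a1 cmpm1 -/l => e.
have {}e : fmap unsh (fmap sh l) = fmap unsh c.
  by rewrite -[LHS]cmp1m -b1 -cmpA e cmpA b1 cmp1m.
by rewrite fmapB e subrr.
Qed.

Lemma shift_faithful n X Y (f : Hom X Y) : fmap (shift C n) f = 0 -> f = 0.
Proof.
case: n => n; apply: iterF_faithful; [exact: sh_faithful|exact: unsh_faithful].
Qed.

Lemma shiftNK n X : isomorphic (shift C (- n) (shift C n X)) X.
Proof.
case: n => [[|n]|n]; first exact: isomorphic_refl.
  exact: (@iterF_cancel C sh unsh n.+1) unsh_sh_isom.
exact: (@iterF_cancel C unsh sh n.+1) sh_unsh_isom.
Qed.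

Lemma shift_succ_isom n X : isomorphic (shift C n (sh X)) (shift C (n + 1) X).
Proof.
rewrite -succzE; case: n => [n|[|n]].
- exact: isomorphic_refl.
- exact: unsh_sh_isom.
- exact: (@isomorphic_fmap _ _ (iterF n.+1 unsh)) (unsh_sh_isom X).
Qed.

Lemma sh_shift_isom n X : isomorphic (sh (shift C n X)) (shift C (n + 1) X).
Proof.
apply: isomorphic_trans (shift_succ_isom n X).
case: n => n; first by rewrite /= iterF_swap; apply: isomorphic_refl.
apply: (@isomorphic_trans _ (iterF n unsh X)).
  by rewrite /= iterF_swap; apply: sh_unsh_isom.
rewrite /=; apply: (@isomorphic_fmap _ _ (iterF n unsh)).
exact/isomorphic_sym/unsh_sh_isom.
Qed.

Lemma homz_shift n X Y : homz (shift C n X) (shift C n Y) -> homz X Y.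
Proof. by move=> z f; apply: (@shift_faithful n); apply: z. Qed.

Lemma shift_succ_natural n X Y (f : Hom X Y) :
  shift_succ n Y \co fmap (shift C n) (fmap sh f)
  = fmap (shift C (succz n)) f \co shift_succ n X.
Proof.
case: n => [n|[|n]] /=; first by rewrite cmp1m cmpm1.
  exact: (nt_natural (@unsh_sh C) f).
by rewrite -!fmapM; do 2! congr (fmap _ _); exact: (nt_natural (@unsh_sh C) f).
Qed.

Lemma dist_cmp0 X Y Z (f : Hom X Y) (g : Hom Y Z) (h : Hom Z (sh X)) :
  dist f g h -> g \co f = 0.
Proof.
move=> d; have [O zO] := has_zero C.
have [|c + _] := dist_mor (dist_id X zO) d (a := idm X) (b := f); first by [].
by rewrite cmpm0.
Qed.

Lemma dist_weak_coker X Y Z (f : Hom X Y) (g : Hom Y Z) (h : Hom Z (sh X))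
    T (k : Hom Y T) : dist f g h -> k \co f = 0 -> exists l, k = l \co g.
Proof.
move=> d kf; have [O zO] := has_zero C.
have dT : dist (0 : Hom O T) (idm T) (0 : Hom T (sh O)).
  apply/dist_rot; rewrite fmap0 oppr0; apply: dist_id.
  by rewrite /is_zero -fmap1 zO fmap0.
have [|c + _] := dist_mor d dT (a := 0) (b := k); first by rewrite kf cmp0m.
by rewrite cmp1m => e; exists c.
Qed.

Lemma dist_weak_ker X Y Z (f : Hom X Y) (g : Hom Y Z) (h : Hom Z (sh X))
    T (k : Hom T Y) : dist f g h -> g \co k = 0 -> exists l, k = f \co l.
Proof.
move=> /dist_rot d gk; have [O zO] := has_zero C.
have /dist_rot dT := dist_id T zO.
have [|c _] := dist_mor dT d (a := k) (b := 0); first by rewrite gk cmp0m.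
rewrite fmap1 cmpNr cmpNl cmpm1 => /oppr_inj; have [l ->] := sh_full c.
rewrite -fmapM => e; exists l; apply/eqP; rewrite -subr_eq0; apply/eqP.
by apply: sh_faithful; rewrite fmapB e subrr.
Qed.

End TriangleTheory.

Section WeightTheory.
Variables (C : triangulated_cat) (w : weight_structure C).
Implicit Types X Y Z : C.

Lemma shifted_iso (P : C -> Prop) i X Y :
  isomorphic X Y -> shifted P i Y -> shifted P i X.
Proof. by move=> XY [Z PZ YZ]; exists Z => //; apply: isomorphic_trans YZ. Qed.

Lemma shifted_shift (P : C -> Prop) i X : P X -> shifted P i (shift C i X).
Proof. by exists X => //; apply: isomorphic_refl. Qed.

Lemma wleq_sh i X : wleq w i X -> wleq w (i + 1) (sh X).
Proof.
case=> X0 X0w XX0; exists X0 => //.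
exact: isomorphic_trans (isomorphic_fmap sh XX0) (sh_shift_isom i X0).
Qed.

Lemma wgeqW i X : wgeq w (i + 1) X -> wgeq w i X.
Proof.
case=> X0 X0w XX0; exists (sh X0).
  by apply/wge_shift/shifted_shift.
exact/(isomorphic_trans XX0)/isomorphic_sym/shift_succ_isom.
Qed.

Lemma w_orthi i X Y : wleq w i X -> wgeq w (i + 1) Y -> homz X Y.
Proof.
case=> X0 X0w XX0 [Y0 Y0w YY0].
apply: (@homz_iso _ (shift C i X0) (shift C i (sh Y0))).
- exact: isomorphic_sym.
- exact/(isomorphic_trans (shift_succ_isom i Y0))/isomorphic_sym.
apply: (@homz_shift _ (- i)).
apply: homz_iso (isomorphic_sym (shiftNK i _)) (isomorphic_sym (shiftNK i _)) _.
by apply: (w_orth X0w); apply: (@shifted_shift _ 1).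
Qed.

Lemma wle_crit X : (forall Y, wge w Y -> homz X (sh Y)) -> wle w X.
Proof.
move=> z; have [L [R [f [g [h [Lw [R0 R0w RR0] d]]]]]] := w_decomp w X.
have g0 : g = 0.
  exact: (homz_iso (isomorphic_refl X) (isomorphic_sym RR0) (z _ R0w) g).
have [|l e] := dist_weak_ker (k := idm X) d; first by rewrite cmpm1.
by apply: wle_retract Lw _; exists l, f.
Qed.

Lemma wge_crit Y : (forall X, wle w X -> homz X (sh Y)) -> wge w Y.
Proof.
move=> z; have [L [R [f [g [h [Lw [R0 R0w RR0] d]]]]]] := w_decomp w (sh Y).
have [|l e] := dist_weak_coker (k := idm (sh Y)) d.
  by rewrite (z _ Lw f) cmpm0.
have Rw : wge w (unsh R).
  apply: retract_closed_iso (@wge_retract _ w) _ R0w.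
  exact: isomorphic_trans (isomorphic_fmap unsh RR0) (unsh_sh_isom R0).
apply: retract_closed_iso (@wge_retract _ w) (isomorphic_sym (unsh_sh_isom Y)) _.
by apply: wge_retract Rw _; exists (fmap unsh g), (fmap unsh l);
  rewrite -fmapM -e fmap1.
Qed.

Variables (M : C) (D : wdata w M).

Lemma wt_gr_le i Z : wgeq w (i + 1) Z -> homz (wt_gr D i) Z.
Proof.
move=> Zw f; have /dist_rot d := wt_gr_dist D i.
have [|l ->] := dist_weak_coker (k := f) d.
  exact: w_orthi (wt_leP D i) Zw _.
have lw : wleq w i (sh (wt_le D (i - 1))).
  by rewrite -{1}(subrK 1 i); apply: wleq_sh; apply: wt_leP.
by rewrite (w_orthi lw Zw l) cmp0m.
Qed.

Lemma wt_gr_ge i X : wleq w (i - 1) X -> homz X (wt_gr D i).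
Proof.
move=> Xw f.
have geP : wgeq w i (wt_ge D (i - 1 + 1)) by rewrite subrK; apply: wt_geP.
have orth k Y : wleq w (k - 1) Y -> forall Z, wgeq w k Z -> homz Y Z.
  by move=> Yw Z Zw; apply: w_orthi Yw _; rewrite subrK.
have shK (Y Z : C) (a : Hom Y Z) : fmap sh a = 0 -> a = 0 by apply: sh_faithful.
have d1 := wt_gr_dist D i; have /dist_rot d2 := d1; have /dist_rot d3 := d2.
have /dist_rot/dist_rot e1 := wt_dist D (i - 1).
have vf0 : wt_v D i \co f = 0.
  have [|l ->] := dist_weak_ker (k := wt_v D i \co f) e1.
    rewrite cmpNl -wt_jE fmapM -cmpA.
    have := dist_cmp0 d3; rewrite cmpNl => /eqP; rewrite oppr_eq0 => /eqP e.
    by rewrite (cmpA _ (wt_v D i)) e cmp0m cmpm0 oppr0.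
  by rewrite (orth _ _ Xw _ geP l) cmpm0.
have [e ->] := dist_weak_ker d2 vf0.
have [|e' he] := dist_weak_ker (k := wt_h D i \co e) (wt_dist D (i - 1)).
  exact: orth Xw _ geP _.
have h0 : wt_h D i \co (e - wt_j D i \co e') = 0.
  by rewrite cmpBr cmpA wt_jE he subrr.
have /dist_rot/dist_rot e2 := wt_dist D i.
have [|l el] := dist_weak_ker (k := fmap sh (e - wt_j D i \co e')) e2.
  by rewrite cmpNl -fmapM h0 fmap0 oppr0.
have Xw1 : wleq w i (sh X) by rewrite -(subrK 1 i); apply: wleq_sh.
move: el; rewrite (w_orthi Xw1 (wt_geP D (i + 1)) l) cmpm0 => /shK /eqP.
by rewrite subr_eq0 => /eqP ->; rewrite cmpA (dist_cmp0 d1) cmp0m.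
Qed.

Lemma wterm_in_heart p : in_heart w (shift C p (wt_gr D (- p))).
Proof.
split.
- apply: wle_crit => Y Yw; apply: (@homz_shift _ (- p)).
  apply: homz_iso (isomorphic_sym (shiftNK p _)) (isomorphic_refl _) _.
  apply: wt_gr_le; apply: shifted_iso (shift_succ_isom (- p) Y) _.
  exact: shifted_shift.
- apply: wge_crit => X Xw; apply: (@homz_shift _ (- (p + 1))).
  apply: homz_iso (isomorphic_refl _) _ _.
  + apply: isomorphic_fmap; apply: isomorphic_sym; apply: sh_shift_isom.
  apply: homz_iso (isomorphic_refl _) (isomorphic_sym (shiftNK _ _)) _.
  by apply: wt_gr_ge; rewrite -opprD; apply: shifted_shift.
Qed.

End WeightTheory.

Section WeightComplex.
Variables (C : triangulated_cat) (w : weight_structure C).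

(* [M_i -> w_{<= i-1} M [1] -> M_{i-1}[1]] *)
Definition wt_d (M : C) (D : wdata w M) (i : int) :
    Hom (wt_gr D i) (sh (wt_gr D (i - 1))) :=
  fmap sh (wt_u D (i - 1)) \co wt_v D i.

(* [M_i[p] -> M_{i-1}[1][p] = M_{i-1}[p + 1]]; the equations allow [q] and [k]
   to be any expressions for [p + 1] and [i - 1]. *)
Definition wt_diff (M : C) (D : wdata w M) (p q i k : int)
    (eq : succz p = q) (ek : i - 1 = k) :
    Hom (shift C p (wt_gr D i)) (shift C q (wt_gr D k)) :=
  match eq in _ = q, ek in _ = k return Hom _ (shift C q (wt_gr D k)) with
  | erefl, erefl => shift_succ p _ \co fmap (shift C p) (wt_d D i)
  end.

(* [M^p = M_{-p}[p]] *)
Definition wterm (M : C) (D : wdata w M) (p : int) : heart w :=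
  exist _ (shift C p (wt_gr D (- p))) (wterm_in_heart D p).

Definition wdiff (M : C) (D : wdata w M) (p : int) :
    Hom (wterm D p) (wterm D (p + 1)) :=
  wt_diff D (succzE p) (esym (opprD p 1)).

Lemma wt_diffK (M : C) (D : wdata w M) p q r i k l
    (eq : succz p = q) (ek : i - 1 = k) (er : succz q = r) (el : k - 1 = l) :
  wt_diff D er el \co wt_diff D eq ek = 0.
Proof.
case: q / eq er => er; case: r / er; case: k / ek el => el; case: l / el => /=.
rewrite -cmpA (cmpA (fmap (shift C _) _)) -shift_succ_natural.
rewrite -(cmpA (shift_succ p _)) -fmapM.
suff -> : fmap sh (wt_d D (i - 1)) \co wt_d D i = 0.
  by rewrite fmap0 !cmpm0.
rewrite /wt_d fmapM -cmpA (cmpA (fmap sh (wt_v D _))) -fmapM.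
have /dist_rot/dist_cmp0 -> := wt_gr_dist D (i - 1).
by rewrite fmap0 cmp0m cmpm0.
Qed.

Lemma wdiffK (M : C) (D : wdata w M) p : wdiff D (p + 1) \co wdiff D p = 0.
Proof. exact: wt_diffK. Qed.

Definition wcomplex (M : C) (D : wdata w M) : complex (heart w) :=
  Complex (wdiffK D).

Section Maps.
Variables (M N : C) (g : Hom M N) (D : wdata w M) (E : wdata w N).
Variable G : wmor g D E.

Definition wterm_map (p : int) : Hom (wterm D p) (wterm E p) :=
  fmap (shift C p) (wm_gr G (- p)).

Lemma wt_diff_natural p q i k (eq : succz p = q) (ek : i - 1 = k) :
  fmap (shift C q) (wm_gr G k) \co wt_diff D eq ek
  = wt_diff E eq ek \co fmap (shift C p) (wm_gr G i).
Proof.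
case: q / eq; case: k / ek => /=.
rewrite cmpA -shift_succ_natural -!cmpA -!fmapM /wt_d; congr (_ \co fmap _ _).
by rewrite cmpA -fmapM wm_u fmapM -!cmpA wm_v.
Qed.

Lemma wcomplex_map_subproof p :
  wterm_map (p + 1) \co diff (wcomplex D) p
  = diff (wcomplex E) p \co wterm_map p.
Proof. exact: wt_diff_natural. Qed.

Definition wcomplex_map : chain_map (wcomplex D) (wcomplex E) :=
  @ChainMap (heart w) (wcomplex D) (wcomplex E) wterm_map wcomplex_map_subproof.

End Maps.

Variable A : abelian_cat.

(* [H^F(M)] computed from the data [D]. *)
Definition wH0 (F : functor (heart w) A) (M : C) (D : wdata w M) : A :=
  H0 (mapK F (wcomplex D)).

Definition wH0map (F : functor (heart w) A) (M N : C) (g : Hom M N)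
    (D : wdata w M) (E : wdata w N) (G : wmor g D E) :
    Hom (wH0 F D) (wH0 F E) :=
  H0map (mapC F (wcomplex_map G)).

Definition wH0nat (F F' : functor (heart w) A) (phi : ntrans F F')
    (M : C) (D : wdata w M) : Hom (wH0 F D) (wH0 F' D) :=
  H0map (mapN phi (wcomplex D)).

End WeightComplex.

(* Main.v *)
Require Import Defs.
From mathcomp Require Import all_boot ssralg ssrint.
From mathcomp Require Import boolp.

(** Why the theorem holds.

   A morphism g : M -> N extends to chosen weight data because a map from an
   object of weight at most i to an object of weight at least i + 1 is zero: the
   composites w_{<= i} M -> M -> N lift to w_{<= i} N, two lifts agree after one
   more transition map, and the cones are filled in by TR3 ([wmor_ex]). The
   extension is not unique, and two extensions need not be chain homotopic. Their
   difference c at degree zero is only weakly null homotopic, c = d z + y d with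
   unrelated z and y ([wmor_null]). An additive functor preserves such a formula,
   and the formula makes c vanish on homology ([H0map_null]), so the induced map
   depends on g alone ([wH0map_indep]). Functoriality, additivity, independence of
   the choices (the comparison maps are those induced by identities) and
   naturality in the functor all follow.

   Exactness at H(Y) for a triangle X -f-> Y -g-> Z -> X[1] is the substantial
   part. The model is the mapping cone: a cycle l of Y whose image in the cone
   bounds (k, l') is homologous to the image of the cycle k of X. What the chase
   uses of this is a set of four identities between morphisms of the heart, which
   survive any additive functor ([H0_exact]). By independence they are needed for
   one choice of weight data only. That choice takes w_{<= i} Z to be a cone of
   w_{<= i-1} X -> w_{<= i} Y for i = 0, 1. The cone W of w_{<= 0} X -> w_{<= 0} Y
   lies between them, and everything is read off the tower

     w_{<= 0} Z -> W -> w_{<= 1} Z -> Z,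

   whose first two maps have cones X_0[1] and Y_1 by the octahedral axiom
   ([cone_tower]), while the last has a cone of weight at least 2
   ([cone_decomposition]). The map w_{<= 0} Z -> Z is by definition the composite of
   the tower, so no compatibility of independently built 3 x 3 diagrams is ever
   required ([cone_identities]).

   Homology in the abelian category is handled with generalized elements, lifted
   after passing to an epimorphism, which is legitimate because epimorphisms are
   stable under pullback ([epi_pullback]). *)

Set Implicit Arguments.
Unset Strict Implicit.
Unset Printing Implicit Defensive.
Import GRing.Theory.
Local Open Scope cat_scope.

(** * Preliminaries *)

Section Preliminaries.
Local Open Scope ring_scope.
Local Open Scope cat_scope.

Lemma cmpBl (C : precat) (X Y Z : C) (g g' : Hom Y Z) (f : Hom X Y) :
  (g - g') \co f = g \co f - g' \co f.
Proof. by rewrite cmpDl cmpNl. Qed.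

Lemma oppr_cmp (C : precat) (X Y Z : C) (g : Hom Y Z) (f : Hom X Y) :
  (- g) \co f = g \co - f.
Proof. by rewrite cmpNl cmpNr. Qed.

Lemma dep_choice (I : Type) (T : I -> Type) (P : forall i, T i -> Prop) :
  (forall i, exists y, P i y) -> exists f : forall i, T i, forall i, P i (f i).
Proof. by move=> exP; exists (fun i => projT1 (cid (exP i))) => i; case: cid. Qed.

(** Choice with one prescribed value. The prescribed value lives in the type of
   index [k], so it is imposed on index [i] only through a cast along [k = i];
   the casts are harmless because [int] has decidable equality. *)
Lemma choice_at (T : int -> Type) (P : forall i, T i -> Prop) k (x : T k) :
  P k x -> (forall i, exists y, P i y) ->
  exists2 f : forall i, T i, f k = x & forall i, P i (f i).
Proof.
move=> Px exP.
have /dep_choice [f fP] : forall i, exists y : T i,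
    P i y /\ forall e : k = i, ecast j (T j) e x = y.
  move=> i; have [e|ne] := eqVneq k i; last first.
    by have [y Py] := exP i; exists y; split=> // e; rewrite e eqxx in ne.
  by case: i / e; exists x; split=> // e; rewrite (eq_irrelevance e erefl).
exists f; last by move=> i; have [] := fP i.
by have [_ /(_ erefl)] := fP k.
Qed.

(** Weight data index the truncation [wt_ge] by all integers but constrain it at
   indices of the form [i + 1]; every integer is one, in a unique way. *)
Lemma choice_succ (T : int -> Type) (P : forall i, T (i + 1) -> Prop) :
  (forall i, exists y, P i y) ->
  exists f : forall k, T k, forall i, P i (f (i + 1)).
Proof.
move=> exP.
have /dep_choice [f fP] : forall k, exists y : T k,
    forall i (e : k = i + 1), P i (ecast j (T j) e y).
  move=> k; rewrite -(subrK 1 k); have [y Py] := exP (k - 1).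
  exists y => i e; have ei := addIr 1 e; case: i / ei in e *.
  by rewrite (eq_irrelevance e erefl).
by exists f => i; apply: (fP _ _ erefl).
Qed.

End Preliminaries.

(** * Generalized elements and homology in an abelian category *)

Section Chase.
Local Open Scope ring_scope.
Local Open Scope cat_scope.
Variable A : abelian_cat.
Implicit Types X Y Z W : A.

Lemma epi_eq0 X Y (f : Hom X Y) :
  (forall W (g : Hom Y W), g \co f = 0 -> g = 0) -> epi f.
Proof.
by move=> f0 W g h e; apply/eqP; rewrite -subr_eq0 (f0 _ (g - h)) // cmpBl e subrr.
Qed.

Lemma epi_cancel0 X Y (f : Hom X Y) W (g : Hom Y W) :
  epi f -> g \co f = 0 -> g = 0.
Proof. by move=> fE gf; apply: fE; rewrite gf cmp0m. Qed.

Lemma epi_comp X Y Z (g : Hom Y Z) (f : Hom X Y) : epi g -> epi f -> epi (g \co f).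
Proof. by move=> gE fE W a b; rewrite !cmpA => /fE/gE. Qed.

Lemma cokerm_epi X Y (f : Hom X Y) : epi (cokerm f).
Proof.
move=> W g h e; have [c0 U] := cokermP f.
have [|l [_ Ul]] := U W (h \co cokerm f); first by rewrite -cmpA c0 cmpm0.
by rewrite -(Ul g e) -(Ul h erefl).
Qed.

(** An epimorphism is a cokernel of its own kernel: it is the cokernel of some map,
   and that map factors through the kernel. *)
Lemma epi_desc X Y (f : Hom X Y) K (k : Hom K X) W (g : Hom X W) :
  epi f -> is_kernel f k -> g \co k = 0 -> exists l, g = l \co f.
Proof.
move=> /epi_normal [V [v [fv Uf]]] [_ Uk] gk.
have [v' [kv _]] := Uk _ _ fv.
have [|l [<- _]] := Uf _ g; first by rewrite -kv cmpA gk cmp0m.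
by exists l.
Qed.

(** The pullback of [f] and [g] is the kernel of their difference on the biproduct.
   That difference is epi because [g] is, hence it is the cokernel of the pullback;
   a map killed by [p] then descends along it and vanishes on the summand [Y]. *)
Lemma epi_pullback X Y Z (f : Hom X Z) (g : Hom Y Z) : epi g ->
  exists P (p : Hom P X) (q : Hom P Y), epi p /\ f \co p = g \co q.
Proof.
move=> gE; have [S [i [j [p [q [pi qj qi pj ipjq]]]]]] := has_biproducts X Y.
pose m := f \co p - g \co q.
have mj : m \co j = - g by rewrite cmpBl -!cmpA pj qj cmpm0 cmpm1 sub0r.
have mi : m \co i = f by rewrite cmpBl -!cmpA pi qi cmpm0 cmpm1 subr0.
have mE : epi m.
  apply: epi_eq0 => W h hm; apply: epi_cancel0 gE _.
  by apply/eqP; rewrite -oppr_eq0 -cmpNr -mj cmpA hm cmp0m.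
exists (ker m), (p \co kerm m), (q \co kerm m); split; last first.
  by apply/eqP; rewrite -subr_eq0 !cmpA -cmpBl (kermP m).1.
apply: epi_eq0 => W h; rewrite cmpA => /(epi_desc mE (kermP m)) [l e].
have l0 : l = 0.
  apply: epi_cancel0 gE _; apply/eqP.
  by rewrite -oppr_eq0 -cmpNr -mj cmpA -e -cmpA pj cmpm0.
by rewrite -(cmpm1 h) -pi cmpA e l0 !cmp0m.
Qed.

(** The kernel of the cokernel of [f] is its image, and [f] should map onto it. If
   [u] kills the corestriction, then [f] factors through the kernel of [u]; as a
   mono this kernel is the kernel of some [r], which kills [f], hence its image, so
   the kernel of [u] is everything. *)
Lemma image_epi X Y (f : Hom X Y) : epi (ker_lift (cokermP f).1).
Proof.
set c := cokerm f; set e := ker_lift _; have ie : kerm c \co e = f by apply: ker_liftK.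
apply: epi_eq0 => W u ue.
have kE : kerm u \co ker_lift ue = e by apply: ker_liftK.
have /mono_normal [T [r [rk Ur]]] : mono (kerm c \co kerm u).
  by move=> V a b; rewrite -!cmpA => /kerm_mono/kerm_mono.
have rf : r \co f = 0.
  by rewrite -ie -kE !cmpA -(cmpA r) rk cmp0m.
have ri : r \co kerm c = 0.
  by rewrite -(coker_descK rf) -cmpA (kermP c).1 cmpm0.
have [l [kl _]] := Ur _ _ ri.
have {}kl : kerm u \co l = idm _.
  by apply: (@kerm_mono _ _ _ c); rewrite cmpA kl cmpm1.
by rewrite -(cmpm1 u) -kl cmpA (kermP u).1 cmp0m.
Qed.

(** Elementwise exactness at the target of [f]: an element that dies in the cokernel
   comes from the source after an epimorphic change of the test object. *)
Lemma coker_lift X Y (f : Hom X Y) W (x : Hom W Y) : cokerm f \co x = 0 ->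
  exists P (p : Hom P W) (y : Hom P X), epi p /\ x \co p = f \co y.
Proof.
move=> x0; have [P [p [y [pE e]]]] := epi_pullback (ker_lift x0) (@image_epi _ _ f).
exists P, p, y; split=> //.
by rewrite -(ker_liftK x0) -cmpA e cmpA ker_liftK.
Qed.

Lemma exact_at_lift X Y Z (f : Hom X Y) (g : Hom Y Z) : g \co f = 0 ->
  (forall W (x : Hom W Y), g \co x = 0 ->
     exists P (p : Hom P W) (y : Hom P X), epi p /\ x \co p = f \co y) ->
  exact_at f g.
Proof.
move=> gf0 lift; exists gf0.
have [P [p [y [pE e]]]] := lift _ _ (kermP g).1.
have pl : p = ker_lift gf0 \co y.
  by apply: kerm_mono; rewrite e cmpA ker_liftK.
have c0 : cokerm (ker_lift gf0) = 0.
  by apply: epi_cancel0 pE _; rewrite pl cmpA (cokermP _).1 cmp0m.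
by apply: cokerm_epi; rewrite cmp1m cmp0m.
Qed.

Section HomologyClass.
Variables (X Y Z : A) (f : Hom X Y) (g : Hom Y Z) (gf0 : g \co f = 0).

(** The homology class of a cycle, seen as a generalized element. *)
Definition hclass W (x : Hom W Y) (gx0 : g \co x = 0) : Hom W (homology gf0) :=
  cokerm (ker_lift gf0) \co ker_lift gx0.

Lemma hclassD W (x y s : Hom W Y) (x0 : g \co x = 0) (y0 : g \co y = 0)
    (s0 : g \co s = 0) : s = x + y -> hclass s0 = hclass x0 + hclass y0.
Proof.
by move=> e; rewrite -cmpDr; congr (_ \co _); apply: kerm_mono; rewrite cmpDr !ker_liftK.
Qed.

Lemma hclass_comp W V (x : Hom W Y) (p : Hom V W) (y : Hom V Y)
    (x0 : g \co x = 0) (y0 : g \co y = 0) :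
  y = x \co p -> hclass y0 = hclass x0 \co p.
Proof.
by move=> e; rewrite -cmpA; congr (_ \co _); apply: kerm_mono; rewrite cmpA !ker_liftK.
Qed.

Lemma hclass_boundary W (x : Hom W Y) (x0 : g \co x = 0) (y : Hom W X) :
  x = f \co y -> hclass x0 = 0.
Proof.
move=> e; have -> : hclass x0 = cokerm (ker_lift gf0) \co (ker_lift gf0 \co y).
  by congr (_ \co _); apply: kerm_mono; rewrite cmpA !ker_liftK.
by rewrite cmpA (cokermP _).1 cmp0m.
Qed.

Lemma hclass_eq0 W (x : Hom W Y) (x0 : g \co x = 0) : hclass x0 = 0 ->
  exists P (p : Hom P W) (y : Hom P X), epi p /\ x \co p = f \co y.
Proof.
move=> /coker_lift [P [p [y [pE e]]]]; exists P, p, y; split=> //.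
by rewrite -(ker_liftK x0) -cmpA e cmpA ker_liftK.
Qed.

Lemma hclass_surj W (x : Hom W (homology gf0)) :
  exists P (p : Hom P W) (y : Hom P Y) (y0 : g \co y = 0),
    epi p /\ x \co p = hclass y0.
Proof.
have [P [p [q [pE e]]]] := epi_pullback x (@cokerm_epi _ _ (ker_lift gf0)).
have y0 : g \co (kerm g \co q) = 0 by rewrite cmpA (kermP g).1 cmp0m.
exists P, p, _, y0; split=> //; rewrite e; congr (_ \co _).
by apply: kerm_mono; rewrite ker_liftK.
Qed.

(** The class of the universal cycle [kerm g] is the quotient map onto homology,
   which is epi. *)
Lemma homology_ext T (a b : Hom (homology gf0) T) :
  (forall W (x : Hom W Y) (x0 : g \co x = 0), a \co hclass x0 = b \co hclass x0) ->
  a = b.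
Proof.
move=> e; apply: cokerm_epi; have := e _ _ (kermP g).1.
by rewrite /hclass (_ : ker_lift _ = idm _) ?cmpm1 //;
  apply: kerm_mono; rewrite ker_liftK cmpm1.
Qed.

End HomologyClass.

(** The terms of a complex occurring in [H0] are those at [-1], [-1 + 1] and
   [-1 + 1 + 1]; this restates [hclass] with the convertible indices. *)
Definition H0class (K : complex A) (W : A) (x : Hom W (K 0))
    (x0 : diff K 0 \co x = 0) : Hom W (H0 K) :=
  @hclass _ _ _ (diff K (-1)) (diff K 0) (diffK K (-1)) W x x0.

Lemma H0map_class (K L : complex A) (f : chain_map K L) W (x : Hom W (K 0))
    (x0 : diff K 0 \co x = 0) (y : Hom W (L 0)) (y0 : diff L 0 \co y = 0) :
  y = f 0 \co x -> H0map f \co H0class x0 = H0class y0.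
Proof.
move=> e; rewrite /H0map /homology_map /H0class /hclass cmpA coker_descK -cmpA.
congr (_ \co _); apply: kerm_mono; rewrite cmpA !ker_liftK -cmpA.
by rewrite (ker_liftK (x0 : diff K 0 \co x = 0)).
Qed.

Lemma chain_cycle (K L : complex A) (f : chain_map K L) W (x : Hom W (K 0)) :
  diff K 0 \co x = 0 -> diff L 0 \co (f 0 \co x) = 0.
Proof. by move=> x0; rewrite cmpA -(cm_diff f 0) -cmpA x0 cmpm0. Qed.

Lemma H0map_id (K : complex A) (f : chain_map K K) :
  f 0 = idm (K 0) -> H0map f = idm (H0 K).
Proof.
move=> e; apply: homology_ext => W x x0.
by rewrite cmp1m (@H0map_class _ _ f _ _ x0 _ x0) // e cmp1m.
Qed.

Lemma H0map_comp (K L M : complex A) (g : chain_map L M) (f : chain_map K L)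
    (h : chain_map K M) :
  h 0 = g 0 \co f 0 -> H0map h = H0map g \co H0map f.
Proof.
move=> e; apply: homology_ext => W x x0.
have y0 := chain_cycle f x0; have z0 := chain_cycle g y0.
rewrite -cmpA (H0map_class x0 y0 erefl) (H0map_class y0 z0 erefl).
by rewrite (@H0map_class _ _ h _ _ x0 _ z0) // e cmpA.
Qed.

Lemma H0map_sub (K L : complex A) (f g h : chain_map K L) :
  h 0 = f 0 - g 0 -> H0map h = H0map f - H0map g.
Proof.
move=> e; apply/eqP; rewrite eq_sym subr_eq; apply/eqP; apply: homology_ext => W x x0.
rewrite cmpDl (H0map_class x0 (chain_cycle f x0) erefl).
rewrite (H0map_class x0 (chain_cycle g x0) erefl).
rewrite (H0map_class x0 (chain_cycle h x0) erefl).
by apply: hclassD; rewrite e cmpBl subrK.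
Qed.

(** The two maps [s] and [r] are unrelated, which is weaker than a homotopy: on
   cycles the second term vanishes and the first is a boundary. *)
Lemma H0map_null (K L : complex A) (f : chain_map K L)
    (s : Hom (K 0) (L (-1))) (r : Hom (K 1) (L 0)) :
  f 0 = (diff L (-1) : Hom _ (L 0)) \co s + r \co diff K 0 -> H0map f = 0.
Proof.
move=> e; apply: homology_ext => W x x0.
rewrite (H0map_class x0 (chain_cycle f x0) erefl) cmp0m.
apply: (@hclass_boundary _ _ _ _ _ _ _ _ _ (s \co x)).
by rewrite e cmpDl -!cmpA [diff K 0 \co x]x0 cmpm0 addr0.
Qed.

(** The mapping cone argument without a cone. If [M] were the cone of [a], then
   [t] and [s] would be its projections to [L], while [r] and [e] would be its
   projections to the shift of [K], up to sign. The projection [t]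
   need split [b] only up to a term that vanishes on cycles, and likewise for [e]. A cycle [x] of [L] with
   [b x = d z] satisfies [x = t b x = t d z = d (s z) + a (r z)], and [r z] is a
   cycle since [d (r z) = e d z = e b x = 0]. *)
Lemma H0_exact (K L M : complex A) (a : chain_map K L) (b : chain_map L M)
    (t : Hom (M 0) (L 0)) (s : Hom (M (-1)) (L (-1))) (r : Hom (M (-1)) (K 0))
    (e : Hom (M 0) (K 1)) (u : Hom (L 1) (L 0)) (v : Hom (L 1) (K 1)) :
  H0map b \co H0map a = 0 ->
  t \co b 0 = idm (L 0) + u \co diff L 0 ->
  e \co b 0 = v \co diff L 0 ->
  t \co (diff M (-1) : Hom _ (M 0))
    = (diff L (-1) : Hom _ (L 0)) \co s + a 0 \co r ->
  diff K 0 \co r = e \co (diff M (-1) : Hom _ (M 0)) ->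
  exact_at (H0map a) (H0map b).
Proof.
move=> ba0 tb eb td dr; apply: exact_at_lift => // W x0 bx0.
have [P [p [x [dx [pE xp]]]]] := hclass_surj x0.
have bx := chain_cycle b dx.
have : H0class bx = 0.
  rewrite -(H0map_class (dx : diff L 0 \co x = 0) bx erefl) -[H0class _]xp.
  by rewrite cmpA bx0 cmp0m.
move=> bx_eq0; have [Q [q [z [qE zE]]]] := hclass_eq0 bx_eq0.
have dz : diff K 0 \co (r \co z) = 0.
  rewrite cmpA dr -cmpA -[X in e \co X]zE !cmpA eb -!cmpA.
  by rewrite (cmpA _ x) [diff L 0 \co x]dx cmp0m cmpm0.
exists Q, (p \co q), (H0class dz); split; first exact: epi_comp.
have az := chain_cycle a dz.
have xq : diff L 0 \co (x \co q) = 0.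
  by rewrite cmpA [diff L 0 \co x]dx cmp0m.
have sz : diff L 0 \co ((diff L (-1) : Hom _ (L 0)) \co (s \co z)) = 0.
  by rewrite cmpA [X in X \co _](diffK L (-1)) cmp0m.
rewrite cmpA xp (H0map_class dz az erefl) -(hclass_comp _ _ xq erefl).
rewrite (@hclassD _ _ _ _ _ _ _ _ _ _ sz az xq).
  by rewrite (hclass_boundary _ sz erefl) add0r.
rewrite !cmpA -cmpDl -td -!cmpA -[X in t \co X]zE !cmpA tb -!cmpA cmpDl cmp1m.
by rewrite -!cmpA (cmpA _ x) [diff L 0 \co x]dx cmp0m cmpm0 addr0.
Qed.

End Chase.

(** * Distinguished triangles *)

Section Triangles.
Local Open Scope ring_scope.
Local Open Scope cat_scope.
Variable C : triangulated_cat.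
Implicit Types X Y Z T : C.

Section Triangle.
Variables (X Y Z : C) (f : Hom X Y) (g : Hom Y Z) (h : Hom Z (sh X)).
Hypothesis d : dist f g h.

Lemma dist_lift_h T (k : Hom T (sh X)) :
  fmap sh f \co k = 0 -> exists l, k = h \co l.
Proof.
move=> k0; have /dist_rot/dist_rot dr := d.
by apply: (dist_weak_ker dr); rewrite cmpNl k0 oppr0.
Qed.

Lemma dist_desc_h T (k : Hom Z T) : k \co g = 0 -> exists l, k = l \co h.
Proof. by move=> kg; apply: (dist_weak_coker (proj1 (dist_rot _ _ _) d)). Qed.

Lemma dist_lift_sh T (k : Hom T (sh Y)) :
  fmap sh g \co k = 0 -> exists l, k = fmap sh f \co l.
Proof.
move=> k0; have /dist_rot/dist_rot/dist_rot dr := d.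
have [|l ->] := dist_weak_ker (k := k) dr; first by rewrite cmpNl k0 oppr0.
by exists (- l); rewrite oppr_cmp.
Qed.

Lemma dist_desc_sh T (k : Hom (sh Y) T) :
  k \co fmap sh f = 0 -> exists l, k = l \co fmap sh g.
Proof.
move=> k0; have /dist_rot/dist_rot/dist_rot dr := d.
have [|l ->] := dist_weak_coker (k := k) dr; first by rewrite cmpNr k0 oppr0.
by exists (- l); rewrite oppr_cmp.
Qed.

End Triangle.

Lemma sh_inj X Y (f g : Hom X Y) : fmap sh f = fmap sh g -> f = g.
Proof.
by move=> e; apply/eqP; rewrite -subr_eq0; apply/eqP/sh_faithful; rewrite fmapB e subrr.
Qed.

Lemma shiftKN n X : isomorphic (shift C n (shift C (- n) X)) X.
Proof. by have := shiftNK (- n) X; rewrite opprK. Qed.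

(** The transpose of [f] under the adjoint equivalence between [unsh] and [sh].
   Degree [-1] of a weight complex involves [unsh], so identities proved with [sh]
   are carried there by transposition. *)
Definition unsh_adj X Y (f : Hom X (sh Y)) : Hom (unsh X) Y :=
  unsh_sh Y \co fmap unsh f.

Lemma unsh_adjM X Y Z (g : Hom Y Z) (f : Hom X (sh Y)) :
  unsh_adj (fmap sh g \co f) = g \co unsh_adj f.
Proof.
by rewrite /unsh_adj fmapM cmpA [X in X \co _](nt_natural (@unsh_sh C) g) -cmpA.
Qed.

Lemma unsh_adjMr X Y Z (g : Hom Y (sh Z)) (f : Hom X Y) :
  unsh_adj (g \co f) = unsh_adj g \co fmap unsh f.
Proof. by rewrite /unsh_adj fmapM cmpA. Qed.

Lemma unsh_adjD X Y (f g : Hom X (sh Y)) :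
  unsh_adj (f + g) = unsh_adj f + unsh_adj g.
Proof. by rewrite /unsh_adj fmapD cmpDr. Qed.

End Triangles.

(** * Weights and weight data *)

Section Weights.
Local Open Scope ring_scope.
Local Open Scope cat_scope.
Variables (C : triangulated_cat) (w : weight_structure C).
Implicit Types X Y Z T M N : C.

(** Orthogonality conditions pass to extensions, so testing weights by orthogonality
   gives [wleq_ext] and, through its dual, [wgeq_ext]. *)
Lemma wleq_crit i X : (forall Y, wgeq w (i + 1) Y -> homz X Y) -> wleq w i X.
Proof.
move=> z; exists (shift C (- i) X); last exact/isomorphic_sym/shiftKN.
apply: wle_crit => Y Yw; apply: (@homz_shift _ i).
apply: homz_iso (isomorphic_sym (shiftKN i _)) (isomorphic_refl _) _.
by apply: z; apply: shifted_iso (shift_succ_isom i Y) _; apply: shifted_shift.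
Qed.

Lemma wgeq_crit i Y : (forall X, wleq w (i - 1) X -> homz X Y) -> wgeq w i Y.
Proof.
move=> z; exists (shift C (- i) Y); last exact/isomorphic_sym/shiftKN.
apply: wge_crit => X Xw; apply: (@homz_shift _ (i - 1)).
apply: (homz_iso (isomorphic_refl _) _ (z _ (shifted_shift (i - 1) Xw))).
apply: isomorphic_trans (isomorphic_fmap _ (isomorphic_sym (sh_shift_isom _ _))).
have -> : - i + 1 = - (i - 1) by rewrite opprB addrC.
exact/isomorphic_sym/shiftKN.
Qed.

Lemma wgeq_sh i X : wgeq w i X -> wgeq w (i + 1) (sh X).
Proof.
case=> X0 X0w XX0; exists X0 => //.
exact: isomorphic_trans (isomorphic_fmap sh XX0) (sh_shift_isom i X0).
Qed.

Lemma wleq_ext i X Y Z (f : Hom X Y) (g : Hom Y Z) (h : Hom Z (sh X)) :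
  dist f g h -> wleq w i X -> wleq w i Z -> wleq w i Y.
Proof.
move=> d Xw Zw; apply: wleq_crit => T Tw k.
have [|l ->] := dist_weak_coker (k := k) d; first exact: w_orthi Xw Tw _.
by rewrite (w_orthi Zw Tw l) cmp0m.
Qed.

Lemma wgeq_ext i X Y Z (f : Hom X Y) (g : Hom Y Z) (h : Hom Z (sh X)) :
  dist f g h -> wgeq w i X -> wgeq w i Z -> wgeq w i Y.
Proof.
rewrite -(subrK 1 i) => d Xw Zw; apply: wgeq_crit; rewrite subrK => T Tw k.
have [|l ->] := dist_weak_ker (k := k) d; first exact: w_orthi Tw Zw _.
by rewrite (w_orthi Tw Xw l) cmpm0.
Qed.

(** By the octahedral axiom, a cone of a composite is an extension of the two cones. *)
Lemma wgeq_cone_comp i X Y Z U V W (f : Hom X Y) (g : Hom Y Z)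
    (a : Hom Y U) (a' : Hom U (sh X)) (b : Hom Z V) (b' : Hom V (sh Y))
    (c : Hom Z W) (c' : Hom W (sh X)) :
  dist f a a' -> dist g b b' -> dist (g \co f) c c' ->
  wgeq w i U -> wgeq w i V -> wgeq w i W.
Proof.
move=> da db dc Uw Vw; have [s [t [d _ _ _ _]]] := dist_oct da db dc.
by apply: wgeq_ext d Uw Vw.
Qed.

Section Data.
Variables (M : C) (D : wdata w M).

Lemma wt_gr_wgeq i : wgeq w i (wt_gr D i).
Proof. by apply: wgeq_crit => X; apply: wt_gr_ge. Qed.

Lemma wleq_sh_wt_le i : wleq w i (sh (wt_le D (i - 1))).
Proof. by rewrite -{1}(subrK 1 i); apply: wleq_sh; apply: wt_leP. Qed.

Lemma wt_lift i X (k : Hom X M) : wleq w i X -> exists l, k = wt_h D i \co l.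
Proof.
move=> Xw; apply: dist_weak_ker (wt_dist D i) _.
exact: w_orthi Xw (wt_geP D (i + 1)) _.
Qed.

(** Two lifts to [w_{<= i} M] differ by a map through [w_{>= i+1} M] shifted by
   [-1], which has weight at least [i] only. Uniqueness therefore needs a source of
   weight at most [i - 1]. *)
Lemma wt_lift_eq0 i X (k : Hom X (wt_le D i)) :
  wleq w (i - 1) X -> wt_h D i \co k = 0 -> k = 0.
Proof.
move=> Xw hk; apply: sh_faithful.
have [|l ->] := dist_lift_h (k := fmap sh k) (wt_dist D i).
  by rewrite -fmapM hk fmap0.
have Xw1 : wleq w i (sh X) by rewrite -(subrK 1 i); apply: wleq_sh.
by rewrite (w_orthi Xw1 (wt_geP D (i + 1)) l) cmpm0.
Qed.

Lemma wt_lift_inj i X (k l : Hom X (wt_le D i)) :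
  wleq w (i - 1) X -> wt_h D i \co k = wt_h D i \co l -> k = l.
Proof.
move=> Xw e; apply/eqP; rewrite -subr_eq0; apply/eqP.
by apply: wt_lift_eq0 => //; rewrite cmpBr e subrr.
Qed.

Lemma wt_u_desc i N (k : Hom (sh (wt_le D i)) N) :
  homz (sh (wt_le D (i - 1))) N -> exists l, k = l \co fmap sh (wt_u D i).
Proof. by move=> z; apply: (dist_desc_sh (wt_gr_dist D i)); apply: z. Qed.

(** A map killed by [wt_u] factors through [wt_v], and then through the next graded
   piece, since the hypothesis kills its restriction along the
   transition map. *)
Lemma wt_d_desc i N (k : Hom (wt_gr D i) N) :
  homz (sh (wt_le D (i - 1 - 1))) N -> k \co wt_u D i = 0 ->
  exists l, k = l \co wt_d D i.
Proof.
move=> z ku; have [l ->] := dist_desc_h (wt_gr_dist D i) ku.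
by have [m ->] := wt_u_desc l z; exists m; rewrite cmpA.
Qed.

End Data.

(** The key to independence of all choices. The lifts [wm_le] of the zero map die
   after one transition map, so their shifts factor through [wt_v] of the target;
   this gives the term [wt_d E i \co z]. Subtracting it from [wm_gr] leaves a map
   killed by [wt_u] of the source, hence a multiple of [wt_d D (i - 1)]. The
   identity is shifted once because [wt_d] raises the shift. *)
Lemma wmor_null i M N (g : Hom M N) (D : wdata w M) (E : wdata w N)
    (G : wmor g D E) : g = 0 ->
  exists (z : Hom (sh (wt_gr D (i - 1))) (wt_gr E i))
         (y : Hom (sh (wt_gr D (i - 1 - 1))) (wt_gr E (i - 1))),
    fmap sh (wm_gr G (i - 1))
      = wt_d E i \co z + fmap sh (y \co wt_d D (i - 1)).
Proof.
move=> g0.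
have ja : wt_j E i \co wm_le G (i - 1) = 0.
  apply: wt_lift_eq0; first exact: wt_leP.
  by rewrite cmpA wt_jE -wm_h g0 cmp0m.
have [|x ax] := dist_lift_h (k := fmap sh (wm_le G (i - 1))) (wt_gr_dist E i).
  by rewrite -fmapM ja fmap0.
have [|z xz] := wt_u_desc x.
  by move=> k; apply: wt_gr_ge (wleq_sh_wt_le D (i - 1)) _.
have [e de] := sh_full (wt_d E i \co z).
have [||y cy] := @wt_d_desc _ D (i - 1) _ (wm_gr G (i - 1) - e).
- by move=> k; apply: wt_gr_ge (wleq_sh_wt_le D (i - 1 - 1)) _.
- apply: sh_inj; rewrite cmpBl fmapB !fmapM -de -fmapM wm_u fmapM ax xz.
  by rewrite /wt_d !cmpA subrr fmap0.
by exists z, y; rewrite de -fmapD -cy [e + _]addrC (subrK e).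
Qed.

End Weights.

(** * Extending morphisms to weight data *)

Section Morphisms.
Local Open Scope ring_scope.
Local Open Scope cat_scope.

Variables (C : triangulated_cat) (w : weight_structure C).
Implicit Types X Y Z T M N : C.

Section Extension.
Variables (M N : C) (g : Hom M N) (D : wdata w M) (E : wdata w N).
Variable le : forall i, Hom (wt_le D i) (wt_le E i).
Hypothesis leh : forall i, g \co wt_h D i = wt_h E i \co le i.

(** Both sides lift the same map out of an object of weight at most [i - 1]. *)
Lemma wt_le_map_j i : le i \co wt_j D i = wt_j E i \co le (i - 1).
Proof.
apply: wt_lift_inj; first exact: wt_leP.
by rewrite !cmpA -leh wt_jE -leh -cmpA wt_jE.
Qed.

Lemma wt_gr_map_ex i : exists c : Hom (wt_gr D i) (wt_gr E i),
  c \co wt_u D i = wt_u E i \co le i /\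
  fmap sh (le (i - 1)) \co wt_v D i = wt_v E i \co c.
Proof.
by have [c] := dist_mor (wt_gr_dist D i) (wt_gr_dist E i) (wt_le_map_j i); exists c.
Qed.

(** Only the lifts and the maps of graded pieces have to be specified: they may be
   chosen independently at each index, since compatibility with [wt_j] is
   automatic. *)
Lemma wmor_extend (gr : forall i, Hom (wt_gr D i) (wt_gr E i)) :
  (forall i, gr i \co wt_u D i = wt_u E i \co le i /\
     fmap sh (le (i - 1)) \co wt_v D i = wt_v E i \co gr i) ->
  exists G : wmor g D E, wm_le G = le /\ wm_gr G = gr.
Proof.
move=> grP.
have [|ge geP] := @choice_succ (fun k => Hom (wt_ge D k) (wt_ge E k))
  (fun i c => c \co wt_r D i = wt_r E i \co g /\
     fmap sh (le i) \co wt_b D i = wt_b E i \co c).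
  by move=> i; have [c] := dist_mor (wt_dist D i) (wt_dist E i) (leh i); exists c.
by exists (WMor leh (fun i => (geP i).1) (fun i => (geP i).2) wt_le_map_j
  (fun i => (grP i).1) (fun i => (grP i).2)).
Qed.

End Extension.

Lemma wmor_at_le k M N (g : Hom M N) (D : wdata w M) (E : wdata w N)
    (a : Hom (wt_le D k) (wt_le E k)) : g \co wt_h D k = wt_h E k \co a ->
  exists G : wmor g D E, wm_le G k = a.
Proof.
move=> ah; have [|le lek leh] := @choice_at (fun i => Hom (wt_le D i) (wt_le E i))
  (fun i c => g \co wt_h D i = wt_h E i \co c) _ _ ah.
  by move=> i; apply: wt_lift (wt_leP D i).
have /dep_choice [gr grP] := wt_gr_map_ex leh.
by have [G [Gle _]] := wmor_extend leh grP; exists G; rewrite Gle.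
Qed.

Lemma wmor_ex M N (g : Hom M N) (D : wdata w M) (E : wdata w N) :
  inhabited (wmor g D E).
Proof.
have [a ah] := wt_lift E (g \co wt_h D 0) (wt_leP D 0).
by have [G _] := wmor_at_le ah; exists.
Qed.

Lemma wmor_at_gr k M N (g : Hom M N) (D : wdata w M) (E : wdata w N)
    (G : wmor g D E) (c : Hom (wt_gr D k) (wt_gr E k)) :
  c \co wt_u D k = wt_u E k \co wm_le G k ->
  fmap sh (wm_le G (k - 1)) \co wt_v D k = wt_v E k \co c ->
  exists G' : wmor g D E, wm_gr G' k = c.
Proof.
move=> cu cv.
have [|gr grk grP] := @choice_at (fun i => Hom (wt_gr D i) (wt_gr E i))
  (fun i c => c \co wt_u D i = wt_u E i \co wm_le G i /\
     fmap sh (wm_le G (i - 1)) \co wt_v D i = wt_v E i \co c) k c (conj cu cv).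
  exact: wt_gr_map_ex (wm_h G).
by have [G' [_ G'gr]] := wmor_extend (wm_h G) grP; exists G'; rewrite G'gr.
Qed.

Section Operations.
Variables (L M N : C) (D1 : wdata w L) (D2 : wdata w M) (D3 : wdata w N).

Lemma wmor_id_gr : exists G : wmor (idm L) D1 D1, wm_gr G = fun i => idm _.
Proof.
have h i : idm L \co wt_h D1 i = wt_h D1 i \co idm _ by rewrite cmp1m cmpm1.
have [|G [_ Ggr]] := @wmor_extend _ _ _ _ _ _ h (fun i => idm _).
  by move=> i; rewrite fmap1 !cmp1m !cmpm1.
by exists G.
Qed.

Lemma wmor_comp_gr (g : Hom M N) (f : Hom L M) (G : wmor g D2 D3) (F : wmor f D1 D2) :
  exists H : wmor (g \co f) D1 D3, wm_gr H = fun i => wm_gr G i \co wm_gr F i.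
Proof.
have h i : (g \co f) \co wt_h D1 i = wt_h D3 i \co (wm_le G i \co wm_le F i).
  by rewrite cmpA -(wm_h G) -!cmpA (wm_h F).
have [|H [_ Hgr]] := @wmor_extend _ _ _ _ _ _ h (fun i => wm_gr G i \co wm_gr F i).
  move=> i; split; first by rewrite -cmpA (wm_u F) !cmpA (wm_u G).
  by rewrite fmapM -cmpA (wm_v F) !cmpA (wm_v G).
by exists H.
Qed.

Lemma wmor_sub_gr (g f : Hom L M) (G : wmor g D1 D2) (F : wmor f D1 D2) :
  exists H : wmor (g - f) D1 D2, wm_gr H = fun i => wm_gr G i - wm_gr F i.
Proof.
have h i : (g - f) \co wt_h D1 i = wt_h D2 i \co (wm_le G i - wm_le F i).
  by rewrite cmpBl cmpBr (wm_h G) (wm_h F).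
have [|H [_ Hgr]] := @wmor_extend _ _ _ _ _ _ h (fun i => wm_gr G i - wm_gr F i).
  by move=> i; rewrite fmapB !cmpBl !cmpBr (wm_u G) (wm_u F) (wm_v G) (wm_v F).
by exists H.
Qed.

End Operations.

(** The integer equations in the type of [wdiff] are between closed integers, so
   their proofs may be replaced by reflexivity. *)
Lemma wdiff_prev M (D : wdata w M) :
  (wdiff D (-1) : Hom (unsh (wt_gr D 1)) (wt_gr D 0)) = unsh_adj (wt_d D 1).
Proof.
rewrite /wdiff; move: (succzE (-1)) (esym (opprD (-1) 1)) => /= e1 e2.
by rewrite (eq_irrelevance e1 erefl) (eq_irrelevance e2 erefl).
Qed.

Lemma wdiff_next M (D : wdata w M) :
  (wdiff D 0 : Hom (wt_gr D 0) (sh (wt_gr D (-1)))) = wt_d D 0.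
Proof.
rewrite /wdiff; move: (succzE 0) (esym (opprD 0 1)) => /= e1 e2.
rewrite (eq_irrelevance e1 erefl) (eq_irrelevance e2 erefl) /=.
exact: cmp1m.
Qed.

Variable A : abelian_cat.
Variable F : functor (heart w) A.

(** The weak null homotopy of [wmor_null] at index 1 is a shifted identity;
   transposing it along the invertible [unsh_sh] gives one in degree zero of the
   weight complex. *)
Lemma wH0map_null M N (g : Hom M N) (D : wdata w M) (E : wdata w N)
    (G : wmor g D E) : g = 0 -> wH0map F G = 0.
Proof.
move=> g0; have [z [y e]] := wmor_null 1 G g0.
have [i i1 i2] := unsh_sh_iso (wt_gr D 0).
pose s : Hom (wterm D 0) (wterm E (-1)) := fmap unsh z \co i.
apply: (@H0map_null _ _ _ (mapC F (wcomplex_map G)) (fmap F s)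
  (fmap F (y : Hom (wterm D 1) (wterm E 0)))).
rewrite -[diff _ (-1)]/(fmap F (wdiff E (-1))) -[diff _ 0]/(fmap F (wdiff D 0)).
rewrite -[LHS]/(fmap F (wterm_map G 0)) -!fmapM -fmapD; congr (fmap F _).
rewrite -[LHS]/(wm_gr G 0).
have <- : unsh_adj (fmap sh (wm_gr G 0)) \co i = wm_gr G 0.
  have := nt_natural (@unsh_sh C) (wm_gr G 0); rewrite /unsh_adj /= => ->.
  by rewrite -cmpA i2 cmpm1.
rewrite [fmap sh _]e unsh_adjD cmpDl; congr (_ + _).
  by rewrite unsh_adjMr -cmpA -wdiff_prev.
have := nt_natural (@unsh_sh C) (y \co wt_d D 0); rewrite /unsh_adj /= => ->.
by rewrite -(cmpA (y \co _)) i2 cmpm1 -wdiff_next.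
Qed.

End Morphisms.

(** * Functoriality of the homology of weight complexes *)

Section Functoriality.
Local Open Scope ring_scope.
Local Open Scope cat_scope.
Variables (C : triangulated_cat) (w : weight_structure C) (A : abelian_cat).
Variable F : functor (heart w) A.
Implicit Types X Y Z T L M N : C.

Lemma wH0map_sub M N (g f h : Hom M N) (D : wdata w M) (E : wdata w N)
    (G : wmor g D E) (G' : wmor f D E) (H : wmor h D E) :
  (forall i, wm_gr H i = wm_gr G i - wm_gr G' i) ->
  wH0map F H = wH0map F G - wH0map F G'.
Proof.
move=> e; apply: H0map_sub; rewrite -[RHS]fmapB; congr (fmap F _).
exact: e.
Qed.

Lemma wH0map_indep M N (g g' : Hom M N) (D : wdata w M) (E : wdata w N)
    (G : wmor g D E) (G' : wmor g' D E) : g = g' -> wH0map F G = wH0map F G'.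
Proof.
move=> gg'; have [H He] := wmor_sub_gr G G'.
apply/eqP; rewrite -subr_eq0 -(@wH0map_sub _ _ _ _ _ _ _ G G' H) ?He //.
by rewrite (wH0map_null F H) // gg' subrr.
Qed.

Lemma wH0map_id M (D : wdata w M) (g : Hom M M) (G : wmor g D D) :
  g = idm M -> wH0map F G = idm (wH0 F D).
Proof.
have [H He] := wmor_id_gr D; move=> /(wH0map_indep G H) ->.
apply: H0map_id; rewrite -[RHS]fmap1; congr (fmap F _).
by rewrite -[LHS]/(wm_gr H 0) He.
Qed.

Lemma wH0map_comp L M N (g : Hom M N) (f : Hom L M) (h : Hom L N)
    (D1 : wdata w L) (D2 : wdata w M) (D3 : wdata w N)
    (G : wmor g D2 D3) (G' : wmor f D1 D2) (H : wmor h D1 D3) :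
  h = g \co f -> wH0map F H = wH0map F G \co wH0map F G'.
Proof.
have [K Ke] := wmor_comp_gr G G'; move=> /(wH0map_indep H K) ->.
apply: H0map_comp; rewrite -[RHS]fmapM; congr (fmap F _).
by rewrite -[LHS]/(wm_gr K 0) Ke.
Qed.

End Functoriality.

(** * Weight data with prescribed truncations *)

Section Completion.
Local Open Scope ring_scope.
Local Open Scope cat_scope.
Variables (C : triangulated_cat) (w : weight_structure C).
Variables (M : C) (le : int -> C) (h : forall i, Hom (le i) M).
Hypothesis leP : forall i, wleq w i (le i).
Hypothesis decP : forall i, exists R (r : Hom M R) (b : Hom R (sh (le i))),
  wgeq w (i + 1) R /\ dist (h i) r b.

Let ge k : C := projT1 (cid (decP (k - 1))).

Lemma completion_ge k : wgeq w k (ge k).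
Proof.
by rewrite -{1}(subrK 1 k) /ge; case: cid => R /= [r [b []]].
Qed.

Lemma completion_dist i :
  exists rb : Hom M (ge (i + 1)) * Hom (ge (i + 1)) (sh (le i)),
    dist (h i) rb.1 rb.2.
Proof.
suff K k : k = i -> exists rb : Hom M (projT1 (cid (decP k)))
    * Hom (projT1 (cid (decP k))) (sh (le i)), dist (h i) rb.1 rb.2.
  by apply: K; rewrite addrK.
by move=> ->; case: cid => R /= [r [b [_ d]]]; exists (r, b).
Qed.

Lemma completion_j i : exists j : Hom (le (i - 1)) (le i), h i \co j = h (i - 1).
Proof.
have [R [r [b [Rw d]]]] := decP i.
have [|l ->] := dist_weak_ker (k := h (i - 1)) d; last by exists l.
by apply: (w_orthi (leP (i - 1))); rewrite subrK; apply: wgeqW.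
Qed.

Let rb i := projT1 (cid (completion_dist i)).
Let j i := projT1 (cid (completion_j i)).

Lemma completion_gr i :
  exists G : {Gr : C & (Hom (le i) Gr * Hom Gr (sh (le (i - 1))))%type},
    dist (j i) (projT2 G).1 (projT2 G).2.
Proof. by have [Gr [u [v d]]] := dist_ex (j i); exists (existT _ Gr (u, v)). Qed.

Let gr i := projT1 (cid (completion_gr i)).

(** The truncations [le] and the maps [h] are recovered from the result by
   computation, so that morphisms into prescribed objects need no transport. *)
Definition wdata_completion : wdata w M :=
  @WData C w M le ge leP completion_ge h (fun i => (rb i).1) (fun i => (rb i).2)
    (fun i => projT2 (cid (completion_dist i))) j
    (fun i => projT2 (cid (completion_j i)))
    (fun i => projT1 (gr i)) (fun i => (projT2 (gr i)).1)
    (fun i => (projT2 (gr i)).2) (fun i => projT2 (cid (completion_gr i))).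

End Completion.

(** * Weight data on a cone *)

Section Cone.
Local Open Scope ring_scope.
Local Open Scope cat_scope.
Variables (C : triangulated_cat) (w : weight_structure C).
Implicit Types X Y Z T L M N : C.

(** One half of the 3 x 3 lemma. The map from [LZ] to [Z] passes through a cone
   of the diagonal [LX -> Y]; the octahedra over the two factorizations of the
   diagonal show that the steps have cones [RY] and the shift of [RX]. *)
Lemma cone_decomposition i X Y Z (f : Hom X Y) (g : Hom Y Z) (h : Hom Z (sh X))
    LX RX (hX : Hom LX X) (rX : Hom X RX) (bX : Hom RX (sh LX))
    LY RY (hY : Hom LY Y) (rY : Hom Y RY) (bY : Hom RY (sh LY))
    (a : Hom LX LY) LZ (b : Hom LY LZ) (c : Hom LZ (sh LX)) :
  dist f g h -> dist hX rX bX -> dist hY rY bY -> dist a b c ->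
  hY \co a = f \co hX -> wgeq w (i + 1) RY -> wgeq w i RX ->
  exists hZ : Hom LZ Z, hZ \co b = g \co hY /\
    exists R (r : Hom Z R) (r' : Hom R (sh LZ)),
      wgeq w (i + 1) R /\ dist hZ r r'.
Proof.
move=> df dX dY da e RYw RXw.
have [V [y [p dV]]] := dist_ex (f \co hX).
have := dV; rewrite -e => dV'.
have [s [t [dst sb ty _ _]]] := dist_oct da dY dV'.
have [s' [t' [dst' _ t'y _ _]]] := dist_oct dX df dV.
have {dst'} /dist_rot dt' := dst'.
have [R [r [r' dR]]] := dist_ex (t' \co s).
exists (t' \co s); split; first by rewrite -cmpA sb cmpA t'y.
exists R, r, r'; split=> //; apply: wgeq_cone_comp dst dt' dR RYw _.
exact: wgeq_sh.
Qed.

(** Here [Z] and [Z'] are cones of [a \co j] and [j' \co a], and [W] is a cone of [a].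
   Factoring through [W] exhibits the cones of [Z -> W] and [W -> Z'] as the shift of
   [KX] and as [KY]. *)
Lemma cone_tower X' X Y Y' KX KY (j : Hom X' X) (a : Hom X Y) (j' : Hom Y Y')
    (u : Hom X KX) (v : Hom KX (sh X')) (u' : Hom Y' KY) (v' : Hom KY (sh Y)) :
  dist j u v -> dist j' u' v' ->
  exists Z W Z' (b : Hom Y Z) (c : Hom Z (sh X')) (b' : Hom Y' Z')
         (c' : Hom Z' (sh X)) (s : Hom KX Z) (k : Hom Z W) (q : Hom W (sh KX))
         (l : Hom W Z') (t : Hom Z' KY),
    [/\ dist (a \co j) b c, dist (j' \co a) b' c', dist s k q,
        dist l t (fmap sh (k \co b) \co v')
      & [/\ s \co u = b \co a, c \co s = v & l \co k \co b = b' \co j']].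
Proof.
move=> dX dY.
have [Z [b [c dZ]]] := dist_ex (a \co j).
have [W [y [p dW]]] := dist_ex a.
have [Z' [b' [c' dZ']]] := dist_ex (j' \co a).
have [s [k [ds su kb cs _]]] := dist_oct dX dW dZ.
have [l [t [dl ly _ _ _]]] := dist_oct dW dY dZ'.
exists Z, W, Z', b, c, b', c', s, k, (fmap sh u \co p), l, t.
split=> //; first by rewrite kb.
by rewrite kb.
Qed.

(** The four identities required by [H0_exact], before shifting into the heart.
   The central relation is the decomposition [rE] of [wt_v EZ 1] into a part from
   [Y] and a part from [X_0]: both sides agree after mapping to [W], and the map
   to [W] has [X_0] as its fibre. Composing it with the maps from [w_{<= 0} Z] to
   [Y_0] and to [X_{-1}[1]] yields the last two identities, the component of [f] at
   index 0 being taken to be [t0 \co s]. *)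
Lemma cone_identities X Y Z (f : Hom X Y) (g : Hom Y Z) (h : Hom Z (sh X))
    (D : wdata w X) (E : wdata w Y) (EZ0 : wdata w Z) :
  dist f g h ->
  exists (EZ : wdata w Z) (Gf : wmor f D E) (Gg : wmor g E EZ)
      (t : Hom (wt_gr EZ 0) (wt_gr E 0)) (s : Hom (wt_gr EZ 1) (wt_gr E 1))
      (r : Hom (wt_gr EZ 1) (sh (wt_gr D 0)))
      (e : Hom (wt_gr EZ 0) (sh (wt_gr D (-1))))
      (u : Hom (sh (wt_gr E (-1))) (wt_gr E 0))
      (v : Hom (sh (wt_gr E (-1))) (sh (wt_gr D (-1)))),
    [/\ t \co wm_gr Gg 0 = idm _ + u \co wt_d E 0,
        e \co wm_gr Gg 0 = v \co wt_d E 0,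
        fmap sh t \co wt_d EZ 1 = wt_d E 1 \co s + fmap sh (wm_gr Gf 0) \co r
      & fmap sh (wt_d D 0) \co r = fmap sh e \co wt_d EZ 1].
Proof.
move=> d; have [G] := wmor_ex f D E.
pose a : Hom (wt_le D 0) (wt_le E 0) := wm_le G 0.
pose a' : Hom (wt_le D (-1)) (wt_le E (-1)) := wm_le G (-1).
pose jX : Hom (wt_le D (-1)) (wt_le D 0) := wt_j D 0.
pose jY : Hom (wt_le E 0) (wt_le E 1) := wt_j E 1.
have dX : dist jX (wt_u D 0) (wt_v D 0) := wt_gr_dist D 0.
have dY : dist jY (wt_u E 1) (wt_v E 1) := wt_gr_dist E 1.
have [Z0 [W [Z1 [b0 [c0 [b1 [c1 [s [k [q [l [t1 T]]]]]]]]]]]] := cone_tower a dX dY.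
have {T} [dZ0 dZ1 ds dl [su cs lkb]] := T.
have [|h1 [h1b [R1 [r1 [r1' [R1w dR1]]]]]] := cone_decomposition
  d (wt_dist D 0) (wt_dist E 1) dZ1 _ (wt_geP E (1 + 1)) (wt_geP D 1).
  by rewrite cmpA [wt_h E 1 \co _](wt_jE E 1) [RHS](wm_h G 0).
(* Defined as the composite of the tower, so that l \co k is the transition map. *)
pose h0 := h1 \co (l \co k).
have h0b : h0 \co b0 = g \co wt_h E 0.
  by rewrite -cmpA -(cmpA l) lkb cmpA h1b -cmpA [_ \co jY](wt_jE E 1).
have Z0w : wleq w 0 Z0.
  by have /dist_rot dZ := dZ0; apply: wleq_ext dZ (wt_leP E 0) (wleq_sh_wt_le D 0).
have Z1w : wleq w 1 Z1.
  by have /dist_rot dZ := dZ1; apply: wleq_ext dZ (wt_leP E 1) (wleq_sh_wt_le D 1).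
have [R0 [r0 [r0' dR0]]] := dist_ex h0.
have R0w : wgeq w (0 + 1) R0.
  have [Q [p [p' dQ]]] := dist_ex (l \co k).
  have /dist_rot dk := ds.
  have Qw : wgeq w 1 Q.
    apply: wgeq_cone_comp dk dl dQ _ (wt_gr_wgeq E 1).
    exact: (wgeq_sh (wt_gr_wgeq D 0)).
  exact: wgeq_cone_comp dQ dR1 dR0 Qw (wgeqW R1w).
(* The given data on Z supply the truncations at all other indices. *)
pose le (i : int) : C :=
  match i with Posz 0 => Z0 | Posz 1 => Z1 | _ => wt_le EZ0 i end.
pose hh (i : int) : Hom (le i) Z :=
  match i return Hom (le i) Z with
  | Posz 0 => h0 | Posz 1 => h1 | i' => wt_h EZ0 i' end.
have leP i : wleq w i (le i).
  by case: i => [[|[|i]]|i] //; apply: wt_leP.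
have decP i : exists R (r : Hom Z R) (r' : Hom R (sh (le i))),
    wgeq w (i + 1) R /\ dist (hh i) r r'.
  have gen : exists R (r : Hom Z R) (r' : Hom R (sh (wt_le EZ0 i))),
      wgeq w (i + 1) R /\ dist (wt_h EZ0 i) r r'.
    by exists (wt_ge EZ0 (i + 1)), (wt_r EZ0 i), (wt_b EZ0 i); split;
      [apply: wt_geP | apply: wt_dist].
  case: i gen => [[|[|i]]|i] // _.
    by exists R0, r0, r0'.
  by exists R1, r1, r1'.
pose EZ := wdata_completion leP decP.
have jZ : (wt_j EZ 1 : Hom Z0 Z1) = l \co k.
  by apply: (@wt_lift_inj _ _ _ EZ 1) => //; rewrite (wt_jE EZ 1).
pose uZ : Hom Z0 (wt_gr EZ 0) := wt_u EZ 0.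
pose vZ : Hom (wt_gr EZ 1) (sh Z0) := wt_v EZ 1.
have [Gg b0E] : exists Gg : wmor g E EZ, wm_le Gg 0 = b0.
  by apply: wmor_at_le; rewrite -h0b.
have gb : wm_gr Gg 0 \co wt_u E 0 = uZ \co b0 by rewrite wm_u b0E.
(* TR3 for a' and the identity of w_{<= 0} Y. *)
have [t0 t0b t0v] : exists2 t0 : Hom Z0 (wt_gr E 0),
    t0 \co b0 = wt_u E 0 & wt_v E 0 \co t0 = fmap sh a' \co c0.
  have [|t0] := dist_mor dZ0 (wt_gr_dist E 0) (a := a') (b := idm _).
    by rewrite cmp1m [LHS](wm_j G 0).
  by rewrite cmpm1 => e1 e2; exists t0.
have [t tu] : exists t : Hom (wt_gr EZ 0) (wt_gr E 0), t0 = t \co uZ.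
  apply: (dist_weak_coker (wt_gr_dist EZ 0)).
  exact: (wt_gr_ge (wt_leP EZ (0 - 1))).
have [e eu] : exists e : Hom (wt_gr EZ 0) (sh (wt_gr D (-1))),
    fmap sh (wt_u D (-1)) \co c0 = e \co uZ.
  apply: (dist_weak_coker (wt_gr_dist EZ 0)).
  exact: (w_orthi (wt_leP EZ (-1)) (wgeq_sh (wt_gr_wgeq D (-1)))).
have [t1' _ t1v] : exists2 t1' : Hom (wt_gr EZ 1) (wt_gr E 1),
    t1' \co wt_u EZ 1 = t1
    & fmap sh k \co vZ = (fmap sh (k \co b0) \co wt_v E 1) \co t1'.
  have [|t1' e1 e2] := dist_mor (wt_gr_dist EZ 1) dl (a := k) (b := idm _).
    by rewrite cmp1m jZ.
  by exists t1'; rewrite ?e1 ?cmpm1.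
have [r rE] : exists r : Hom (wt_gr EZ 1) (sh (wt_gr D 0)),
    vZ - fmap sh b0 \co wt_v E 1 \co t1' = fmap sh s \co r.
  apply: (dist_lift_sh ds); rewrite cmpBr t1v fmapM -!cmpA subrr //.
have {}rE : vZ = fmap sh b0 \co wt_v E 1 \co t1' + fmap sh s \co r.
  by rewrite -rE addrC subrK.
(* The component of f at index 0 is only determined up to weak homotopy; with this
   representative the identities below hold on the nose. *)
have [Gf GfE] : exists Gf : wmor f D E, wm_gr Gf 0 = t0 \co s.
  apply: (wmor_at_gr (G := G)).
    by rewrite -cmpA su cmpA t0b.
  by rewrite cmpA t0v -cmpA cs.
have [u uE] : exists u : Hom (sh (wt_gr E (-1))) (wt_gr E 0),
    t \co wm_gr Gg 0 - idm _ = u \co wt_d E 0.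
  apply: (@wt_d_desc _ _ _ E 0).
    exact: (wt_gr_ge (wleq_sh_wt_le E (0 - 1))).
  by rewrite cmpBl -cmpA gb cmpA -tu t0b cmp1m subrr.
have cb : c0 \co b0 = 0 by have /dist_rot := dZ0; apply: dist_cmp0.
have [v vE] : exists v : Hom (sh (wt_gr E (-1))) (sh (wt_gr D (-1))),
    e \co wm_gr Gg 0 = v \co wt_d E 0.
  apply: (@wt_d_desc _ _ _ E 0).
    exact: (w_orthi (wleq_sh_wt_le E (-1)) (wgeq_sh (wt_gr_wgeq D (-1)))).
  by rewrite -cmpA gb cmpA -eu -cmpA cb cmpm0.
exists EZ, Gf, Gg, t, t1', r, e, u, v; split=> //.
- by rewrite -uE addrC subrK.
- rewrite GfE /wt_d cmpA -fmapM -tu [wt_v EZ 1]rE cmpDr !cmpA -!fmapM.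
  by rewrite t0b.
- rewrite /wt_d cmpA -fmapM -eu [wt_v EZ 1]rE cmpDr !cmpA -!fmapM.
  rewrite -(cmpA _ c0 b0) cb cmpm0 fmap0 !cmp0m (add0r (_ \co _)).
  by rewrite -(cmpA _ c0 s) cs.
Qed.

End Cone.

(** * Exactness and naturality *)

Section Exactness.
Local Open Scope ring_scope.
Local Open Scope cat_scope.

(** A split monomorphism after the second map does not change its kernel; this
   transports exactness to other weight data on the third object. *)
Lemma exact_at_split_mono (A : abelian_cat) (X Y Z Z' : A) (f : Hom X Y) (g : Hom Y Z)
    (k : Hom Z Z') (k' : Hom Z' Z) :
  k' \co k = idm Z -> exact_at f g -> exact_at f (k \co g).
Proof.
move=> kk [gf ex]; apply: exact_at_lift => [|W x]; first by rewrite -cmpA gf cmpm0.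
rewrite -cmpA => kgx; have {}gx : g \co x = 0.
  by rewrite -(cmp1m (g \co x)) -kk -cmpA kgx cmpm0.
have h0 : hclass gf gx = 0.
  by rewrite -[LHS](cmp1m (hclass gf gx)) [idm _]ex cmp0m.
exact: hclass_eq0 h0.
Qed.

Variables (C : triangulated_cat) (w : weight_structure C) (A : abelian_cat).
Variable F : functor (heart w) A.

Lemma wH0map_exact (X Y Z : C) (f : Hom X Y) (g : Hom Y Z) (h : Hom Z (sh X))
    (D : wdata w X) (E : wdata w Y) (DZ : wdata w Z)
    (G : wmor f D E) (G' : wmor g E DZ) :
  dist f g h -> exact_at (wH0map F G) (wH0map F G').
Proof.
move=> d.
have [EZ [Gf [Gg [t [s [r [e [u [v [tb eb td dr]]]]]]]]]] :=
  cone_identities D E DZ d.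
have [T] := wmor_ex (idm Z) EZ DZ; have [T'] := wmor_ex (idm Z) DZ EZ.
have [I] := wmor_ex (idm Z) EZ EZ; have [O] := wmor_ex (0 : Hom X Z) D EZ.
rewrite (wH0map_indep F G Gf erefl).
rewrite (wH0map_comp F (f := g) (g := idm Z) T Gg G'); last first.
  by rewrite cmp1m.
apply: (@exact_at_split_mono _ _ _ _ _ _ _ _ (wH0map F T')).
  by rewrite -(wH0map_comp F T' T I) ?cmp1m // (wH0map_id F I).
pose s' : Hom (wterm EZ (-1)) (wterm E (-1)) := fmap unsh s.
pose r' : Hom (wterm EZ (-1)) (wterm D 0) := unsh_adj r.
apply: (@H0_exact _ _ _ _ (mapC F (wcomplex_map Gf)) (mapC F (wcomplex_map Gg))
  (fmap F (t : Hom (wterm EZ 0) (wterm E 0))) (fmap F s') (fmap F r')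
  (fmap F (e : Hom (wterm EZ 0) (wterm D 1)))
  (fmap F (u : Hom (wterm E 1) (wterm E 0)))
  (fmap F (v : Hom (wterm E 1) (wterm D 1)))).
- rewrite -[LHS]/(wH0map F Gg \co wH0map F Gf).
  rewrite -(wH0map_comp F Gg Gf O) ?(wH0map_null F O) //.
  by rewrite (dist_cmp0 d).
- rewrite -[diff _ 0]/(fmap F (wdiff E 0)) -[mapC _ _ 0]/(fmap F (wterm_map Gg 0)).
  by rewrite -[idm _]fmap1 -!fmapM -fmapD; congr (fmap F _); rewrite wdiff_next.
- rewrite -[diff _ 0]/(fmap F (wdiff E 0)) -[mapC _ _ 0]/(fmap F (wterm_map Gg 0)).
  by rewrite -!fmapM; congr (fmap F _); rewrite wdiff_next.
- rewrite -[diff (Defs.mapK F (wcomplex E)) (-1)]/(fmap F (wdiff E (-1))).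
  rewrite -[diff (Defs.mapK F (wcomplex EZ)) (-1)]/(fmap F (wdiff EZ (-1))).
  rewrite -[mapC _ _ 0]/(fmap F (wterm_map Gf 0)).
  rewrite -!fmapM -fmapD; congr (fmap F _); rewrite !wdiff_prev.
  rewrite -[LHS]unsh_adjM td unsh_adjD unsh_adjMr.
  by congr (_ + _); rewrite unsh_adjM.
- rewrite -[diff (Defs.mapK F (wcomplex EZ)) (-1)]/(fmap F (wdiff EZ (-1))).
  rewrite -[diff (Defs.mapK F (wcomplex D)) 0]/(fmap F (wdiff D 0)).
  rewrite -!fmapM; congr (fmap F _); rewrite wdiff_prev wdiff_next.
  by rewrite -[LHS]unsh_adjM -[RHS]unsh_adjM dr.
Qed.

(** Both composites are induced by the same chain map. *)
Lemma wH0nat_natural (F' : functor (heart w) A) (phi : ntrans F F')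
    (M N : C) (g : Hom M N) (D : wdata w M) (E : wdata w N) (G : wmor g D E) :
  wH0nat phi E \co wH0map F G = wH0map F' G \co wH0nat phi D.
Proof.
have comm := nt_natural phi (wterm_map G 0).
have chain p : (phi (wterm E (p + 1)) \co fmap F (wterm_map G (p + 1)))
    \co diff (Defs.mapK F (wcomplex D)) p
  = diff (Defs.mapK F' (wcomplex E)) p
      \co (phi (wterm E p) \co fmap F (wterm_map G p)).
  rewrite -cmpA [X in _ \co X](cm_diff (mapC F (wcomplex_map G)) p).
  by rewrite cmpA [X in X \co _](cm_diff (mapN phi (wcomplex E)) p) -cmpA.
pose H := @ChainMap _ (Defs.mapK F (wcomplex D)) (Defs.mapK F' (wcomplex E))
  (fun p => phi (wterm E p) \co fmap F (wterm_map G p)) chain.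
rewrite -[LHS](@H0map_comp _ _ _ _ _ _ H) //.
by rewrite -[RHS](@H0map_comp _ _ _ _ _ _ H).
Qed.

End Exactness.

Theorem proposition2p3p1
  (C : triangulated_cat) (w : weight_structure C) (A : abelian_cat) :
  exists
    (H : forall (F : functor (heart w) A) (t : forall M : C, wdata w M)
           (M N : C), Hom M N -> Hom (wH0 F (t M)) (wH0 F (t N)))
    (theta : forall (F : functor (heart w) A) (t t' : forall M : C, wdata w M)
           (M : C), Hom (wH0 F (t M)) (wH0 F (t' M))),
  [/\ (* H on morphisms: induced by any extension to the chosen data *)
      forall (F : functor (heart w) A) (t : forall M : C, wdata w M)
             (M N : C) (g : Hom M N),
        inhabited (wmor g (t M) (t N)) /\
        forall G : wmor g (t M) (t N), H F t M N g = wH0map F G,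
      (* H is a homological functor *)
      forall (F : functor (heart w) A) (t : forall M : C, wdata w M),
        homological (F0 := fun M : C => wH0 F (t M)) (H F t),
      (* independence of the choices, up to the canonical isomorphisms *)
      forall (F : functor (heart w) A) (t t' : forall M : C, wdata w M),
        [/\ is_natural (F0 := fun M : C => wH0 F (t M))
                       (G0 := fun M : C => wH0 F (t' M))
                       (H F t) (H F t') (theta F t t'),
            forall M : C, is_iso (theta F t t' M)
          & forall M : C, inhabited (wmor (idm M) (t M) (t' M)) /\
            forall G : wmor (idm M) (t M) (t' M),
              theta F t t' M = wH0map F G]
    & (* naturality in F *)
      [/\ forall (F F' : functor (heart w) A) (phi : ntrans F F')
                 (t : forall M : C, wdata w M),
            is_natural (F0 := fun M : C => wH0 F (t M))
                       (G0 := fun M : C => wH0 F' (t M))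
                       (H F t) (H F' t) (fun M : C => wH0nat phi (t M)),
          forall (F F' : functor (heart w) A) (phi : ntrans F F')
                 (t t' : forall M : C, wdata w M) (M : C),
            theta F' t t' M \co wH0nat phi (t M)
            = wH0nat phi (t' M) \co theta F t t' M,
          forall (F : functor (heart w) A) (t : forall M : C, wdata w M)
                 (M : C),
            wH0nat (idN F) (t M) = idm (wH0 F (t M))
        & forall (F F' F'' : functor (heart w) A)
                 (psi : ntrans F' F'') (phi : ntrans F F')
                 (t : forall M : C, wdata w M) (M : C),
            wH0nat (compN psi phi) (t M)
            = wH0nat psi (t M) \co wH0nat phi (t M)]].
Proof.
have mk (M N : C) (g : Hom M N) (D : wdata w M) (E : wdata w N) :
    {_ : wmor g D E & True}.
  by apply: cid; have [G] := wmor_ex g D E; exists G.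
pose ext M N g D E : wmor g D E := projT1 (mk M N g D E).
exists (fun F t M N g => wH0map F (ext M N g (t M) (t N))).
exists (fun F t t' M => wH0map F (ext M M (idm M) (t M) (t' M))).
split.
- move=> F t M N g; split; first exact: wmor_ex.
  by move=> G; apply: wH0map_indep.
- move=> F t; split; last by move=> X Y Z f g h; apply: wH0map_exact.
  split=> [X|X Y Z g f|X Y f g]; [exact: wH0map_id | exact: wH0map_comp |].
  set G := ext _ _ _ _ _; set Gf := ext _ _ _ _ _; set Gg := ext _ _ _ _ _.
  (* The difference of extensions of f + g and g extends f. *)
  have [H HE] := wmor_sub_gr G Gg.
  have := wH0map_sub F (G := G) (G' := Gg) (H := H).
  rewrite HE => /(_ (fun=> erefl)) e.
  by rewrite (wH0map_indep F Gf H) ?addrK // e subrK.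
- move=> F t t'; split.
  + move=> X Y f.
    rewrite -(wH0map_comp F _ _ (ext X Y f (t X) (t' Y))) ?cmp1m //.
    by apply: wH0map_comp; rewrite cmpm1.
  + move=> M; exists (wH0map F (ext M M (idm M) (t' M) (t M))).
      rewrite -(wH0map_comp F _ _ (ext M M (idm M) (t M) (t M))) ?cmp1m //.
      exact: wH0map_id.
    rewrite -(wH0map_comp F _ _ (ext M M (idm M) (t' M) (t' M))) ?cmp1m //.
    exact: wH0map_id.
  + move=> M; split; first exact: wmor_ex.
    by move=> G; apply: wH0map_indep.
- split.
  + by move=> F F' phi t M N g; apply: wH0nat_natural.
  + by move=> F F' phi t t' M; rewrite wH0nat_natural.
  + by move=> F t M; apply: H0map_id.
  + by move=> F F' F'' psi phi t M; apply: H0map_comp.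
Qed.
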